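(* Let $m,n$ be integers with $1\le m<\frac{n}{2}$, and let $-\frac{2m}{n}<a<+\infty$, $1\le p<\frac{n+2m+2a}{n-2m}$. If $u\in C(\overline{\mathbb{R}^{n}_{+}})$ is a nonnegative solution of the integral equation $$u(x)=\int_{\mathbb{R}^{n}_{+}}G^{+}_{m}(x,y)(y_{n})^{a}u^{p}(y)\,dy$$ on $\mathbb{R}^{n}_{+}$, then $u\equiv0$ in $\overline{\mathbb{R}^{n}_{+}}$.
   Context: $\mathbb{R}^{n}_{+}=\{x=(x_{1},\dots,x_{n})\in\mathbb{R}^{n}\mid x_{n}>0\}$. The Green's function for $(-\Delta)^{m}$ with Navier boundary conditions on $\mathbb{R}^{n}_{+}$ is $$G^{+}_{m}(x,y):=C_{n,m}\left(\frac{1}{|x-y|^{n-2m}}-\frac{1}{|\bar{x}-y|^{n-2m}}\right),\qquad \bar{x}:=(x_{1},x_{2},\dots,-x_{n}),$$ where $C_{n,m}>0$ is the normalizing constant depending only on $n,m$ for which $C_{n,m}|x|^{2m-n}$ is the fundamental solution of $(-\Delta)^{m}$ in $\mathbb{R}^{n}$. *)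

(* Defs.v *)
From HB Require Import structures.
From mathcomp Require Import all_boot all_order all_algebra.
From mathcomp Require Import all_classical all_reals all_analysis.

Set Implicit Arguments.
Unset Strict Implicit.
Unset Printing Implicit Defensive.

Import Order.TTheory GRing.Theory Num.Theory.
Import numFieldNormedType.Exports.

Local Open Scope classical_set_scope.
Local Open Scope ring_scope.

Definition measure_rV_display : measure_display -> measure_display.
Proof. exact. Qed.

Section measurable_rV.
Context {d : measure_display} {T : measurableType d} (n : nat).

Let coors : 'I_n -> 'rV[T]_n -> T := fun i x => x ord0 i.

Let rV_set0 : g_sigma_preimage coors set0.
Proof. exact: sigma_algebra0. Qed.

Let rV_setC A : g_sigma_preimage coors A -> g_sigma_preimage coors (~` A).
Proof. exact: sigma_algebraC. Qed.

Let rV_bigcup (F : (set 'rV[T]_n)^nat) :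
  (forall i, g_sigma_preimage coors (F i)) ->
  g_sigma_preimage coors (\bigcup_i F i).
Proof. exact: sigma_algebra_bigcup. Qed.

(* The product sigma-algebra, i.e. the one generated by the coordinates; over
   the reals it coincides with the Borel sigma-algebra of ['rV[R]_n]. *)
HB.instance Definition _ := @isMeasurable.Build (measure_rV_display d)
  'rV[T]_n (g_sigma_preimage coors) rV_set0 rV_setC rV_bigcup.

End measurable_rV.

Lemma measurable_coord d (T : measurableType d) n (i : 'I_n) :
  measurable_fun [set: 'rV[T]_n] (fun x => x ord0 i).
Proof.
move=> _ Y mY; rewrite setTI; apply: sub_sigma_algebra => /=.
rewrite -bigcup_seq/=; exists i => /=; first by rewrite mem_index_enum.
by exists Y => //; rewrite setTI.
Qed.

Lemma measurable_fun_rVP d1 d2 (T1 : measurableType d1)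
    (T2 : measurableType d2) n (f : T1 -> 'rV[T2]_n) :
  measurable_fun [set: T1] f <->
  forall i, measurable_fun [set: T1] (fun t => f t ord0 i).
Proof.
split=> [mf i|mf].
  by exact: (measurableT_comp (measurable_coord i) mf).
have mS : <<s \big[setU/set0]_(i < n) preimage_set_system setT
    (fun x : 'rV[T2]_n => x ord0 i) measurable >> `<=`
    [set A | measurable (f @^-1` A)].
  apply: smallest_sub.
    split=> [|A mA|F mF]; rewrite /= ?preimage_set0//.
    - by rewrite setTD preimage_setC; exact: measurableC.
    - by rewrite preimage_bigcup; exact: bigcupT_measurable.
  move=> A; rewrite -bigcup_seq => -[i _ [B mB <-]] /=.
  by rewrite setTI -[X in measurable X]setTI; exact: mf.
by move=> _ A mA; rewrite setTI; exact: mS.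
Qed.

Section row_cons.
Context {R : realType} (n : nat).

(* [measurableTypeR R] is [R] as the carrier of [lebesgue_measure]. *)
Definition row_cons (p : measurableTypeR R * 'rV[R]_n) : 'rV[R]_n.+1 :=
  \row_i if unlift ord0 i is Some j then p.2 ord0 j else p.1.

Definition row_uncons (x : 'rV[R]_n.+1) : measurableTypeR R * 'rV[R]_n :=
  (x ord0 ord0, \row_j x ord0 (lift ord0 j)).

Lemma row_consK : cancel row_cons row_uncons.
Proof.
move=> [a x]; rewrite /row_uncons mxE unlift_none; congr pair.
by apply/rowP => j; rewrite !mxE liftK.
Qed.

Lemma measurable_row_cons : measurable_fun setT row_cons.
Proof.
apply/measurable_fun_rVP => i; under eq_fun do rewrite mxE.
case: unliftP => [j _|_]; last exact: measurable_fst.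
by apply: (measurableT_comp (measurable_coord j)); exact: measurable_snd.
Qed.

Lemma measurable_row_uncons : measurable_fun setT row_uncons.
Proof.
apply: measurable_fun_pair; first exact: measurable_coord.
apply/measurable_fun_rVP => i; under eq_fun do rewrite mxE.
exact: measurable_coord.
Qed.

End row_cons.

Section lebesgue_measure_rV.
Context {R : realType}.

Section step.
Context (n : nat) (mu : {sigma_finite_measure set 'rV[R]_n -> \bar R}).

Definition measure_cons : set 'rV[R]_n.+1 -> \bar R :=
  pushforward (lebesgue_measure \x mu)%E (@row_cons R n).

Let measure_cons0 : measure_cons set0 = 0%E.
Proof. by rewrite /measure_cons /pushforward preimage_set0 measure0. Qed.

Let measure_cons_ge0 A : (0 <= measure_cons A)%E.
Proof. exact: (measure_ge0 (lebesgue_measure \x mu)%E). Qed.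

Let measure_cons_sigma_additive : semi_sigma_additive measure_cons.
Proof.
have mrc A : measurable A -> measurable (@row_cons R n @^-1` A).
  by move=> mA; rewrite -[X in measurable X]setTI; exact: measurable_row_cons.
move=> F mF tF mUF; rewrite /measure_cons /pushforward preimage_bigcup.
apply: (measure_semi_sigma_additive (s := (lebesgue_measure \x mu)%E)).
- by move=> k; exact: mrc.
- apply/trivIsetP => /= i j _ _ ij; rewrite -preimage_setI.
  by move/trivIsetP : tF => /(_ _ _ _ _ ij) ->//; rewrite preimage_set0.
- by rewrite -preimage_bigcup; exact: mrc.
Qed.

HB.instance Definition _ := isMeasure.Build _ _ _ measure_cons
  measure_cons0 measure_cons_ge0 measure_cons_sigma_additive.

Let measure_cons_sigma_finite : sigma_finite setT measure_cons.
Proof.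
have /sigma_finiteP[F [FT ndF Foo]] :=
  sigma_finiteT (@lebesgue_measure R : {sigma_finite_measure set _ -> \bar R}).
have /sigma_finiteP[G [GT ndG Goo]] := sigma_finiteT mu.
exists (fun k => @row_uncons R n @^-1` (F k `*` G k)).
  rewrite -preimage_bigcup (_ : \bigcup_k _ = setT) ?preimage_setT//.
  rewrite -subTset => -[a x] _.
  have [i _ Fa] : (\bigcup_i F i) a by rewrite -FT.
  have [j _ Gx] : (\bigcup_i G i) x by rewrite -GT.
  exists (maxn i j) => //; split => /=.
  - by move: a Fa; exact/subsetPset/ndF/leq_maxl.
  - by move: x Gx; exact/subsetPset/ndG/leq_maxr.
move=> k; have [mF Fk] := Foo k; have [mG Gk] := Goo k; split.
  rewrite -[X in measurable X]setTI; apply: measurable_row_uncons => //.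
  exact: measurableX.
rewrite /measure_cons /pushforward -comp_preimage.
rewrite (_ : _ \o _ = id); last by apply/funext => p; exact: row_consK.
by rewrite preimage_id product_measure1E// lte_mul_pinfty// ge0_fin_numE.
Qed.

HB.instance Definition _ := Measure_isSigmaFinite.Build _ _ _ measure_cons
  measure_cons_sigma_finite.

End step.

Fixpoint lebesgue_measure_rV (n : nat) :
    {sigma_finite_measure set 'rV[R]_n -> \bar R} :=
  match n with
  | 0 => dirac (0 : 'rV[R]_0)
  | n'.+1 => measure_cons (lebesgue_measure_rV n')
  end.

Lemma lebesgue_measure_rV_box (n : nat) (A : 'I_n -> set R) :
  (forall i, measurable (A i)) ->
  lebesgue_measure_rV n [set x | forall i, A i (x ord0 i)] =
  (\prod_(i < n) lebesgue_measure (A i))%E.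
Proof.
elim: n A => [|n IHn] A mA.
  by rewrite big_ord0 /= diracE mem_set// => -[].
have mB : measurable [set x : 'rV[R]_n | forall i, A (lift ord0 i) (x ord0 i)].
  rewrite (_ : [set x | _] =
      \bigcap_(i in [set: 'I_n]) [set x : 'rV[R]_n | A (lift ord0 i) (x ord0 i)]).
    apply: fin_bigcap_measurable => // i _.
    by have := measurable_coord i measurableT (mA (lift ord0 i)); rewrite setTI.
  by apply/seteqP; split => x /= Ax i; [move=> _|]; exact: Ax.
rewrite big_ord_recl -IHn// -product_measure1E//=; last exact: mA.
rewrite /measure_cons /pushforward; congr product_measure1; apply/seteqP; split => -[a x] /=.
  move=> Ax; split => [|i]; first by have := Ax ord0; rewrite mxE unlift_none.
  by have := Ax (lift ord0 i); rewrite mxE liftK.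
by move=> [Aa Ax] i; rewrite mxE; case: unliftP => [j ->|->].
Qed.

End lebesgue_measure_rV.

Section euclidean.
Context {R : realType}.

(* The Euclidean norm; the norm [`|x|] of the library on ['rV[R]_n] is the sup
   norm, which induces the same topology. *)
Definition enorm n (x : 'rV[R]_n) : R := Num.sqrt (\sum_i x ord0 i ^+ 2).

(* [|x|^(2m - n)], for [2m < n]; the value at [x = 0] is the junk value 0. *)
Definition riesz n (m : nat) (x : 'rV[R]_n) : R :=
  (enorm x ^+ (n - 2 * m))^-1.

Definition last_coord n : 'rV[R]_n -> R :=
  match n with
  | 0 => fun=> 0
  | n'.+1 => fun x => x ord0 ord_max
  end.

Definition halfspace n : set 'rV[R]_n := [set x | 0 < last_coord x].

Definition reflect_last n (x : 'rV[R]_n) : 'rV[R]_n :=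
  \row_(i < n) if i.+1 == n then - x ord0 i else x ord0 i.

End euclidean.

Section fundamental_solution.
Context {R : realType} (n : nat).
Implicit Types f phi : 'rV[R]_n -> R.

Definition partial (i : 'I_n) f : 'rV[R]_n -> R := 'D_(delta_mx ord0 i) f.

Fixpoint Ck (k : nat) f : Prop :=
  match k with
  | 0 => continuous f
  | k'.+1 => continuous f /\
      forall i, (forall x, derivable f x (delta_mx ord0 i)) /\
                Ck k' (partial i f)
  end.

Definition laplacian f : 'rV[R]_n -> R :=
  fun x => \sum_(i < n) partial i (partial i f) x.

Definition neg_laplacian_iter (m : nat) f : 'rV[R]_n -> R :=
  iter m (fun g x => - laplacian g x) f.

Definition test_function phi : Prop :=
  (forall k, Ck k phi) /\ compact (closure [set x | phi x != 0]).

(* [(- Delta)^m Phi] is the Dirac mass at the origin, in the sense of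
   distributions. *)
Definition is_fundamental_solution (m : nat) (Phi : 'rV[R]_n -> R) : Prop :=
  (forall K : set 'rV[R]_n, compact K ->
     (lebesgue_measure_rV n).-integrable K (EFin \o Phi)) /\
  (forall phi, test_function phi ->
     (\int[lebesgue_measure_rV n]_x (Phi x * neg_laplacian_iter m phi x)%:E =
      (phi 0)%:E)%E).

End fundamental_solution.

(* Green's function of [(- Delta)^m] with Navier boundary conditions on the
   half-space; [C] is the normalizing constant. *)
Definition green_halfspace {R : realType} n (C : R) (m : nat)
    (x y : 'rV[R]_n) : R :=
  C * (riesz m (x - y) - riesz m (reflect_last x - y)).

(* Main.v *)
(** Moving spheres on the integral equation.  Put [g = n - 2m] and let
    [kelvin l u x = (l / |x|)^g u (l^2 x / |x|^2)].  Folding the integral over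
    the outside of the ball of radius [l] back into the ball writes both [u] and
    [kelvin l u] as integrals over the half-ball, and their difference as the
    integral of a positive kernel against
    [y_n^a ((l / |y|)^tau (kelvin l u)^p - u^p)], where
    [tau = n + 2m + 2a - p g > 0].  Hence if the set where [kelvin l u < u] has
    small measure, the supremum of [u - kelvin l u] on the half-ball is at most
    half of itself, and the set is empty; the uniform smallness of
    [\int_A |x - y|^(-g) y_n^a dy] for small [A] is where [a > -2m/n] enters.
    This settles small [l], and, the inequality [u <= kelvin l u] becoming strict
    when [u] is not identically zero, it also extends the inequality past any [l]
    up to which it holds, so it holds for all [l].  It says that
    [t^g u (t^2 x) >= u x] for [t > 1].  On a fixed compact set the equation,
    rescaled, then bounds [t^g u (t^2 x)] below by [b t^tau] times its own minimum
    over that set, which is absurd once [b t^tau >= 2]. *)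

(* The spheres are centred at the origin, a boundary point, because inversion in such a sphere
   preserves the half-space and commutes with the reflection; the Green's function is then
   conformally covariant just as [|x - y|^(-g)] is. Comparing the kernels takes no calculus: in
   squared distances, and inside the ball, both are increments of [t^(-g/2)] of the same length
   [4 x_n y_n], the Kelvin one starting further out. Nothing is known about [u] at infinity or about
   attained suprema, so estimates are made inside balls, where [u] is bounded, and suprema are
   replaced by upper bounds that are halved repeatedly. For [a < 0] the weight is singular along the
   whole boundary and this singularity can meet that of the kernel; a product bound with one factor
   per coordinate handles both, and with [N] the dimension its condition [g / N + max 0 (- a) < 1]
   is equivalent to [a > - 2m / N]. The exponent [tau] counts powers of [l / |y|] under inversion:
   [2 N] from the Jacobian, [- g] absorbed by the kernel, [2 a] from the weight, [- p g] absorbed by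
   the transform of [u]. *)
Require Import Defs.
From mathcomp Require Import all_boot all_order all_algebra.
From mathcomp Require Import all_classical all_reals all_analysis.
From mathcomp Require Import measurable_realfun.
From mathcomp Require Import ring lra.

Set Implicit Arguments.
Unset Strict Implicit.
Unset Printing Implicit Defensive.

Import Order.TTheory GRing.Theory Num.Theory.
Import numFieldNormedType.Exports.

Local Open Scope classical_set_scope.
Local Open Scope ring_scope.

(** * Lebesgue measure under affine maps *)

Local Notation pushforward_measure :=
  measure_function_pushforward__canonical__measure_function_Measure.

Section lebesgue_1d.
Context {R : realType}.
Local Notation leb := (@lebesgue_measure R).

(** Both sides are measures in [A] that agree on the intervals []x, y]], and these determine
    Lebesgue measure. *)
Lemma lebesgue_measure_affine (c b : R) (A : set R) : 0 < c -> measurable A ->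
  (c%:E * leb [set s | A (c * s + b)%R] = leb A)%E.
Proof.
move=> c0 mA; pose phi := (fun s : measurableTypeR R => c * s + b : measurableTypeR R).
have mphi : measurable_fun setT phi.
  by apply: measurable_funD => //; apply: measurable_funM.
have c0' := ltW c0.
pose cn := NngNum c0'.
pose nu0 : {measure set _ -> \bar R} := pushforward_measure leb mphi.
pose nu : {measure set _ -> \bar R} := mscale cn nu0.
suff -> : leb A = nu A by rewrite /nu /mscale.
apply: lebesgue_measure_unique => // _ [[x y]] _ <-.
rewrite /nu /= /mscale /= /pushforward.
rewrite (_ : phi @^-1` _ = `](x - b) / c, (y - b) / c]%classic); last first.
  apply/seteqP; split=> s /=; rewrite !in_itv /= /phi ltr_pdivrMr// ler_pdivlMr//;
    move=> /andP[h1 h2]; apply/andP; split; lra.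
rewrite !lebesgue_measure_itv /= !lte_fin.
rewrite ltr_pM2r ?invr_gt0// ltrD2r; case: ifP => _; last by rewrite mule0.
by rewrite -EFinD -EFinM; congr EFin; field; rewrite gt_eqF.
Qed.

Lemma ge0_integral_affine (c b : R) (f : R -> \bar R) : 0 < c ->
  measurable_fun setT f -> (forall x, 0 <= f x)%E ->
  (c%:E * \int[leb]_s f (c * s + b)%R = \int[leb]_s f s)%E.
Proof.
move=> c0 mf f0; pose phi := (fun s : measurableTypeR R => c * s + b : measurableTypeR R).
have mphi : measurable_fun setT phi.
  by apply: measurable_funD => //; apply: measurable_funM.
have c0' := ltW c0.
pose cn := NngNum c0'.
pose nu0 : {measure set _ -> \bar R} := pushforward_measure leb mphi.
pose nu : {measure set _ -> \bar R} := mscale cn nu0.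
transitivity (\int[nu]_s f s)%E; last first.
  apply: eq_measure_integral => A mA _.
  exact: (lebesgue_measure_affine b c0 mA).
by rewrite ge0_integral_mscale //= ge0_integral_pushforward // preimage_setT.
Qed.

Lemma ge0_integral_oppr (f : R -> \bar R) :
  measurable_fun setT f -> (forall x, 0 <= f x)%E ->
  (\int[leb]_s f (- s)%R = \int[leb]_s f s)%E.
Proof.
move=> mf f0.
have -> : (\int[leb]_s f s = \int[pushforward leb (-%R :
  R -> measurableTypeR R)]_s f s)%E.
  by apply: eq_measure_integral => A mA _; apply/esym; exact: lebesgue_measureN.
by rewrite ge0_integral_pushforward // preimage_setT.
Qed.

End lebesgue_1d.

(** * Lebesgue measure on row vectors *)

Section lebesgue_rV.
Context {R : realType}.
Local Notation leb := (@lebesgue_measure R).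
Local Notation mu := (@lebesgue_measure_rV R).

Lemma ge0_integral_rVS n (f : 'rV[R]_n.+1 -> \bar R) :
  measurable_fun setT f -> (forall x, 0 <= f x)%E ->
  (\int[mu n.+1]_x f x = \int[leb]_s \int[mu n]_z f (row_cons (s, z)))%E.
Proof.
move=> mf f0; rewrite [LHS]ge0_integral_pushforward //; last exact: measurable_row_cons.
rewrite preimage_setT (fubini_tonelli1 (f \o @row_cons R n)) //.
  exact: (measurableT_comp mf (@measurable_row_cons R n)).
by move=> x; exact: f0.
Qed.

Lemma measurable_scaler n (f : 'rV[R]_n -> R) :
  measurable_fun setT f -> measurable_fun setT (fun x : 'rV[R]_n => f x *: x).
Proof.
move=> mf; apply/measurable_fun_rVP => i; under eq_fun do rewrite mxE.
by apply: measurable_funM => //; exact: measurable_coord.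
Qed.

(** One factor [c] per coordinate: Tonelli peels off the first coordinate, which the affine formula
    on the line rescales. *)
Lemma ge0_integral_scaler n (c : R) (f : 'rV[R]_n -> \bar R) : 0 < c ->
  measurable_fun setT f -> (forall x, 0 <= f x)%E ->
  ((c ^+ n)%:E * \int[mu n]_x f (c *: x) = \int[mu n]_x f x)%E.
Proof.
move=> c0; elim: n f => [|n IHn] f mf f0.
  rewrite mul1e; congr integral; apply/funext => x.
  by rewrite (_ : c *: x = x) //; apply/rowP => -[].
have ms : measurable_fun setT (fun x : 'rV[R]_n.+1 => c *: x).
  exact: (measurable_scaler (f := cst c)).
rewrite ge0_integral_rVS //; last exact: (measurableT_comp mf ms).
rewrite ge0_integral_rVS //.
pose F s := (\int[mu n]_z f (row_cons (s, z)))%E.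
have mfc : measurable_fun setT (f \o @row_cons R n).
  exact: (measurableT_comp mf (@measurable_row_cons R n)).
have mF : measurable_fun setT F.
  by apply: (measurable_fun_fubini_tonelli_F (f \o @row_cons R n)) => // x; exact: f0.
have F0 s : (0 <= F s)%E by exact: integral_ge0.
rewrite -(ge0_integral_affine 0 c0 mF F0).
have mz s : measurable_fun setT (fun z => f (row_cons (s, z))).
  exact: (measurableT_comp mfc (pair1_measurable s)).
(* The term [+ 0] gives the integrand the shape produced by the affine formula with [b = 0]. *)
have -> : (\int[leb]_s \int[mu n]_z f (c *: row_cons (s, z))%R =
    \int[leb]_s \int[mu n]_z f (row_cons (c * s + 0, c *: z)%R))%E.
  apply: eq_integral => s _; apply: eq_integral => z _; congr f.
  by apply/rowP => i; rewrite !mxE addr0; case: unliftP => [j _|//]; rewrite mxE.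
rewrite exprS EFinM -muleA; congr (_ * _)%E.
rewrite -ge0_integralZl_EFin //; last 3 first.
- by move=> s _; exact: integral_ge0.
- have mG : measurable_fun setT (fun s : R => \int[mu n]_z f (row_cons (s, c *: z)%R))%E.
    apply: (measurable_fun_fubini_tonelli_F (fun x :
      measurableTypeR R * 'rV[R]_n => f (row_cons (x.1, c *: x.2)))) => //.
    apply: (measurableT_comp mfc (g := fun x : measurableTypeR R * 'rV[R]_n => (x.1, c *:
      x.2))).
    apply: measurable_fun_pair => //=.
    exact: (measurableT_comp (measurable_scaler (f :=
      cst c) (measurable_cst _)) measurable_snd).
  apply: (measurableT_comp mG (g := fun s : R => c * s + 0)).
  by apply: measurable_funD => //; apply: measurable_funM.
- by rewrite exprn_ge0 // ltW.
- apply: eq_integral => s _; apply: (IHn (fun z => f (row_cons (c * s + 0, z)))) => //.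
Qed.

Lemma ge0_integral_prod_coord n (k : 'I_n -> R -> R) :
  (forall i, measurable_fun setT (k i)) -> (forall i s, 0 <= k i s) ->
  (\int[mu n]_x (\prod_i k i (x ord0 i))%:E = \prod_i \int[leb]_s (k i s)%:E)%E.
Proof.
elim: n k => [|n IHn] k mk k0.
  rewrite big_ord0 (eq_integral (cst 1%E)); last by move=> x _; rewrite big_ord0.
  by rewrite integral_cst // mul1e /= diracE mem_set.
have mkc m (i : 'I_m.+1) (g : 'I_m.+1 -> R -> R) : (forall i, measurable_fun setT (g i))
  ->
   measurable_fun setT (fun x : 'rV[R]_m.+1 => g i (x ord0 i)).
  by move=> mg; exact: (measurableT_comp (mg i) (measurable_coord i)).
rewrite ge0_integral_rVS; last 2 first.
- apply/measurable_EFinP; apply: measurable_prod => i _; exact: (mkc _ i k mk).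
- by move=> x; rewrite lee_fin prodr_ge0.
rewrite big_ord_recl.
pose k' i := k (lift ord0 i).
rewrite -(IHn k' (fun i => mk _) (fun i s => k0 _ s)).
rewrite -ge0_integralZr //; last 3 first.
- apply/measurable_EFinP. exact: (mk ord0).
- by move=> s _; rewrite lee_fin.
- apply: integral_ge0 => x _; rewrite lee_fin. apply: prodr_ge0 => i _; exact: k0.
apply: eq_integral => s _; rewrite -ge0_integralZl_EFin //; last 2 first.
- by move=> x _; rewrite lee_fin; apply: prodr_ge0 => i _; exact: k0.
- apply/measurable_EFinP; apply: measurable_prod => i _.
  exact: (measurableT_comp (mk _) (measurable_coord i)).
apply: eq_integral => x _; rewrite big_ord_recl EFinM mxE unlift_none /=.
congr (_ * _%:E)%E; apply: eq_bigr => i _; by rewrite mxE liftK.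
Qed.

Lemma lebesgue_measure_rV_coord n (i : 'I_n) (c : R) :
  mu n [set x : 'rV[R]_n | x ord0 i = c] = 0%E.
Proof.
pose A j := if j == i then [set c] else [set: R].
rewrite (_ : [set x : 'rV[R]_n | x ord0 i = c] = [set x : 'rV[R]_n | forall j, A j (x
  ord0 j)]); last first.
  apply/seteqP; split=> x /=.
    by move=> xc j; rewrite /A; case: eqP => // ->.
  by move/(_ i); rewrite /A eqxx.
rewrite lebesgue_measure_rV_box; last by move=> j; rewrite /A; case: ifP.
by rewrite (bigD1 i) //= /A eqxx lebesgue_measure_set1 mul0e.
Qed.

Lemma measurable_rV_coord n (i : 'I_n) (c : R) :
  measurable [set x : 'rV[R]_n | x ord0 i = c].
Proof.
rewrite -[X in measurable X]setTI.
exact: (measurable_coord i measurableT (measurable_set1 c)).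
Qed.

Lemma measurable_rV_set1 n (x : 'rV[R]_n) : measurable [set x].
Proof.
rewrite (_ : [set x] = \bigcap_(i in [set: 'I_n]) [set y | y ord0 i = x ord0 i]).
  apply: fin_bigcap_measurable => // i _; exact: measurable_rV_coord.
apply/seteqP; split=> y /=; first by move=> -> i.
by move=> h; apply/rowP => i; exact: h.
Qed.

Lemma lebesgue_measure_rV_set1 n (x : 'rV[R]_n.+1) : mu n.+1 [set x] = 0%E.
Proof.
apply: (subset_measure0 (measurable_rV_set1 x) (measurable_rV_coord ord0 (x ord0 ord0))).
  by move=> y ->.
exact: lebesgue_measure_rV_coord.
Qed.

End lebesgue_rV.

(** * The inversion formula *)

Section euclidean_norm.
Context {R : realType} (n : nat).
Implicit Types x y : 'rV[R]_n.

Definition sqnorm x : R := \sum_i x ord0 i ^+ 2.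
Definition dotp x y : R := \sum_i x ord0 i * y ord0 i.

Lemma sqnorm_ge0 x : 0 <= sqnorm x.
Proof. by apply: sumr_ge0 => i _; exact: sqr_ge0. Qed.

Lemma enormE x : enorm x = Num.sqrt (sqnorm x).
Proof. by []. Qed.

Lemma enorm_ge0 x : 0 <= enorm x.
Proof. exact: sqrtr_ge0. Qed.

Lemma sqr_enorm x : enorm x ^+ 2 = sqnorm x.
Proof. by rewrite enormE sqr_sqrtr // sqnorm_ge0. Qed.

Lemma sqr_coord_le_sqnorm x i : x ord0 i ^+ 2 <= sqnorm x.
Proof.
rewrite /sqnorm (bigD1 i) //= lerDl; apply: sumr_ge0 => j _; exact: sqr_ge0.
Qed.

Lemma coord_le_enorm x i : `|x ord0 i| <= enorm x.
Proof. by rewrite -sqrtr_sqr enormE ler_wsqrtr // sqr_coord_le_sqnorm. Qed.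

Lemma enorm0 : enorm (0 : 'rV[R]_n) = 0.
Proof.
rewrite enormE /sqnorm big1 ?sqrtr0 // => i _.
by rewrite mxE expr0n.
Qed.

Lemma enorm_eq0 x : (enorm x == 0) = (x == 0).
Proof.
apply/eqP/eqP => [x0|->]; last exact: enorm0.
apply/rowP => i; rewrite mxE; apply/eqP; rewrite -normr_le0 -x0.
exact: coord_le_enorm.
Qed.

Lemma enorm_gt0 x : (0 < enorm x) = (x != 0).
Proof. by rewrite lt_neqAle enorm_ge0 andbT eq_sym enorm_eq0. Qed.

Lemma sqnormZ (c : R) x : sqnorm (c *: x) = c ^+ 2 * sqnorm x.
Proof.
by rewrite /sqnorm mulr_sumr; apply: eq_bigr => i _; rewrite mxE exprMn.
Qed.

Lemma enormZ (c : R) x : enorm (c *: x) = `|c| * enorm x.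
Proof. by rewrite !enormE sqnormZ sqrtrM ?sqr_ge0 // sqrtr_sqr. Qed.

Lemma sqnormB x y : sqnorm (x - y) = sqnorm x - 2 * dotp x y + sqnorm y.
Proof.
rewrite /sqnorm /dotp mulr_sumr -sumrB -big_split /=.
by apply: eq_bigr => i _; rewrite !mxE; ring.
Qed.

Lemma dotpZl (c : R) x y : dotp (c *: x) y = c * dotp x y.
Proof. by rewrite /dotp mulr_sumr; apply: eq_bigr => i _; rewrite mxE mulrA. Qed.

Lemma dotpC x y : dotp x y = dotp y x.
Proof. by apply: eq_bigr => i _; rewrite mulrC. Qed.

Lemma dotpZr (c : R) x y : dotp x (c *: y) = c * dotp x y.
Proof. by rewrite dotpC dotpZl dotpC. Qed.

Lemma measurable_enorm : measurable_fun setT (@enorm R n).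
Proof.
apply: (@measurableT_comp _ _ _ _ _ _ (@Num.sqrt R)); last first.
  by apply: measurable_sum => i; apply: measurable_funX; exact: measurable_coord.
apply: continuous_measurable_fun; exact: sqrt_continuous.
Qed.

Lemma measurable_enormVX (k : nat) :
  measurable_fun setT (fun x : 'rV[R]_n => (enorm x ^+ k)^-1).
Proof.
(* A real power is measurable; the two expressions agree at [x = 0] too, because [0^-1 = 0]. *)
rewrite (_ : (fun x => _) = (fun x => enorm x `^ (- k%:R))).
  exact: (measurableT_comp (measurable_powR _) measurable_enorm).
by apply/funext => x; rewrite powRN powR_mulrn // enorm_ge0.
Qed.

Lemma enorm_continuous : continuous (@enorm R n).
Proof.
move=> x; apply: continuous_comp; last exact: sqrt_continuous.
apply: (continuous_big add_continuous) => i _ z.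
apply: (@continuous_comp _ _ _ (fun y : 'rV[R]_n => y ord0 i) (fun s : R => s ^+ 2)).
  exact: coord_continuous.
exact: exprn_continuous.
Qed.

(* Fixes [0], because [0^-1 = 0]. *)
Definition inversion (l : R) x : 'rV[R]_n := (l ^+ 2 / enorm x ^+ 2) *: x.

Lemma inversion0 l : inversion l 0 = 0.
Proof. by rewrite /inversion scaler0. Qed.

Lemma enorm_inversion l x : enorm (inversion l x) = l ^+ 2 / enorm x.
Proof.
rewrite /inversion enormZ ger0_norm ?divr_ge0 ?sqr_ge0 //.
have [->|x0] := eqVneq x 0; first by rewrite enorm0 invr0 !mulr0.
by field; rewrite enorm_eq0.
Qed.

Lemma inversion_eq0 l x : l != 0 -> (inversion l x == 0) = (x == 0).
Proof.
move=> l0; rewrite -enorm_eq0 enorm_inversion mulf_eq0 sqrf_eq0 (negbTE l0) /=.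
by rewrite invr_eq0 enorm_eq0.
Qed.

Lemma inversionK l : l != 0 -> involutive (inversion l).
Proof.
move=> l0 x; have [->|x0] := eqVneq x 0; first by rewrite !inversion0.
rewrite {1}/inversion enorm_inversion /inversion scalerA.
rewrite [X in X *: _](_ : _ = 1) ?scale1r //.
by field; rewrite enorm_eq0 x0.
Qed.

Lemma measurable_inversion l : measurable_fun setT (inversion l).
Proof.
apply: measurable_scaler; apply: measurable_funM => //.
exact: measurable_enormVX.
Qed.

Lemma inversion_scaler l (c : R) x : c != 0 -> inversion l (c *: x) = c^-1 *: inversion l
  x.
Proof.
move=> c0; rewrite /inversion enormZ !scalerA; congr (_ *: _).
have [->|x0] := eqVneq x 0; first by rewrite enorm0 !(mulr0, expr0n, invr0, mul0r).
rewrite exprMn real_normK ?num_real //; field.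
by rewrite enorm_eq0 x0 c0.
Qed.

End euclidean_norm.

Section inversion_formula.
Context {R : realType} (n : nat).
Local Notation leb := (@lebesgue_measure R).
Local Notation mu := (lebesgue_measure_rV n).
Implicit Types h f : 'rV[R]_n -> \bar R.

(** The measure [|y|^(-n) dy] is invariant under dilations, and the inversion formula amounts to its
    invariance under inversion. *)
Let ihom h := (\int[mu]_y (h y * ((enorm y ^+ n)^-1)%:E))%E.

Let ihom_scaler h (c : R) : 0 < c -> measurable_fun setT h -> (forall y, 0 <= h y)%E ->
  ihom (fun y => h (c *: y)) = ihom h.
Proof.
move=> c0 mh h0; rewrite /ihom.
rewrite -[RHS](ge0_integral_scaler c0) //; last 2 first.
- apply: emeasurable_funM => //; apply/measurable_EFinP; exact: measurable_enormVX.
- by move=> y; rewrite mule_ge0 // lee_fin invr_ge0 exprn_ge0 // enorm_ge0.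
have mhc : measurable_fun setT (fun y : 'rV[R]_n => h (c *: y)).
  exact: (measurableT_comp mh (measurable_scaler (f := cst c) (measurable_cst _))).
rewrite -ge0_integralZl_EFin //; last 3 first.
- by move=> y _; rewrite mule_ge0 // lee_fin invr_ge0 exprn_ge0 // enorm_ge0.
- apply: emeasurable_funM => //; apply/measurable_EFinP.
  exact: (measurableT_comp (measurable_enormVX _) (measurable_scaler (f :=
    cst c) (measurable_cst _))).
- by rewrite exprn_ge0 // ltW.
apply: eq_integral => y _; rewrite muleCA; congr (_ * _)%E.
rewrite -EFinM enormZ (gtr0_norm c0) exprMn invfM mulrA divff ?mul1r //.
by rewrite expf_neq0 // gt_eqF.
Qed.

(** At [ln (enorm y)], for [y != 0], it selects the annulus between the radii [1] and [e]. Having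
    integral [1] over the line makes it a weight for averaging over dilations. *)
Let shell (t : R) : R := (0 <= t <= 1)%R%:R.

Let shell_ge0 t : 0 <= shell t.
Proof. exact: ler0n. Qed.

Let measurable_shell : measurable_fun setT shell.
Proof.
rewrite (_ : shell = \1_(`[0, 1]%classic)); first exact: measurable_indic.
apply/funext => t; by rewrite /shell indicE mem_setE in_itv.
Qed.

Let integral_shell (b : R) : (\int[leb]_t (shell (t + b))%:E = 1)%E.
Proof.
have ms : measurable_fun setT (EFin \o shell) by exact/measurable_EFinP.
have s0 t : (0 <= (EFin \o shell) t)%E by rewrite lee_fin.
have := ge0_integral_affine b ltr01 ms s0.
rewrite mul1e /=; under eq_integral do rewrite mul1r; move=> ->.
transitivity (\int[leb]_t (\1_(`[0%R, 1%R]%classic : set (measurableTypeR R)) t)%:E)%E.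
  by apply: eq_integral => t _; rewrite /shell indicE mem_setE in_itv.
rewrite integral_indic // setIT.
rewrite [LHS](lebesgue_measure_itv (Interval (BLeft 0) (BRight 1))) /= lte_fin ltr01.
by rewrite -EFinD subr0.
Qed.

(* Insert [1 = \int shell (t + ln |y|) dt] and exchange the integrals: this
   replaces polar coordinates. *)
Let ihom_polar h : measurable_fun setT h -> (forall y, 0 <= h y)%E -> h 0 = 0%E ->
  ihom h = ihom (fun y => (shell (ln (enorm y)))%:E * \int[leb]_t h (expR t *: y))%E.
Proof.
move=> mh h0 h00; have hV0 (y : 'rV[R]_n) : (0 <= ((enorm y ^+ n)^-1)%:E)%E.
  by rewrite lee_fin invr_ge0 exprn_ge0 // enorm_ge0.
have sh0 t : (0 <= (shell t)%:E)%E by rewrite lee_fin.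
have mht : measurable_fun setT
    (fun p : measurableTypeR R * 'rV[R]_n => h (expR p.1 *: p.2)).
  apply: (measurableT_comp mh); apply/measurable_fun_rVP => i.
  under eq_fun do rewrite mxE; apply: measurable_funM.
    exact: (measurableT_comp (@measurable_expR R) measurable_fst).
  exact: (measurableT_comp (measurable_coord i) measurable_snd).
have mln : measurable_fun setT (fun y : 'rV[R]_n => ln (enorm y)).
  exact: (measurableT_comp (@measurable_ln R) (@measurable_enorm R n)).
have msh : measurable_fun setT (fun y : 'rV[R]_n => shell (ln (enorm y))).
  exact: (measurableT_comp measurable_shell mln).
have mV : measurable_fun setT (fun y : 'rV[R]_n => ((enorm y ^+ n)^-1)%:E).
  by apply/measurable_EFinP; exact: measurable_enormVX.
pose W y := (h y * ((enorm y ^+ n)^-1)%:E)%E.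
have mW : measurable_fun setT W by exact: emeasurable_funM.
have W0 y : (0 <= W y)%E by exact: mule_ge0.
have step1 : ihom h = (\int[mu]_y \int[leb]_t (W y * (shell (t + ln (enorm y)))%:E))%E.
  apply: eq_integral => y _; rewrite ge0_integralZl //.
    by rewrite integral_shell mule1.
  apply/measurable_EFinP; apply: (measurableT_comp measurable_shell).
  exact: measurable_funD.
rewrite step1 -(fubini_tonelli (fun p : measurableTypeR R * 'rV[R]_n =>
    (W p.2 * (shell (p.1 + ln (enorm p.2)))%:E)%E)) /=; last 2 first.
- apply: emeasurable_funM; first exact: (measurableT_comp mW measurable_snd).
  apply/measurable_EFinP; apply: (measurableT_comp measurable_shell).
  apply: measurable_funD; first exact: measurable_fst.
  exact: (measurableT_comp mln measurable_snd).
- by move=> p; rewrite mule_ge0.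
pose G (t : measurableTypeR R) (y : 'rV[R]_n) := (h (expR t *: y) * (shell (ln (enorm
  y)))%:E)%E.
have mG t : measurable_fun setT (G t).
  apply: emeasurable_funM; last exact/measurable_EFinP.
  exact: (measurableT_comp mh (measurable_scaler (f := cst (expR t)) (measurable_cst _))).
have G0 t y : (0 <= G t y)%E by exact: mule_ge0.
(* Dilating by [expR t] turns [ln (enorm y)] into [t + ln (enorm y)] and preserves [ihom]; the
   parameter moves from the shell to [h]. *)
have step2 t : (\int[mu]_y (W y * (shell (t + ln (enorm y)))%:E) = ihom (G (- t)%R))%E.
  rewrite -(ihom_scaler (expR_gt0 t)) //; apply: eq_integral => y _.
  rewrite /G /W scalerA -expRD addNr expR0 scale1r.
  (* At the origin [ln] takes a default value and its additivity fails; there [h 0 = 0] makes both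
     sides vanish. *)
  have [->|y0] := eqVneq y 0; first by rewrite h00 !mul0e.
  rewrite enormZ gtr0_norm ?expR_gt0 // lnM ?posrE ?expR_gt0 ?enorm_gt0 //.
  by rewrite expRK muleAC.
under eq_integral do rewrite step2.
have mGV : measurable_fun setT
    (fun p : measurableTypeR R * 'rV[R]_n => (G p.1 p.2 * ((enorm p.2 ^+ n)^-1)%:E)%E).
  apply: emeasurable_funM; last exact: (measurableT_comp mV measurable_snd).
  apply: emeasurable_funM => //; apply/measurable_EFinP.
  exact: (measurableT_comp msh measurable_snd).
have GV0 p : (0 <= G p.1 p.2 * ((enorm p.2 ^+ n)^-1)%:E)%E by exact: mule_ge0.
rewrite (@ge0_integral_oppr _ (fun t => ihom (G t))); last 2 first.
- exact: (measurable_fun_fubini_tonelli_F _ mGV GV0).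
- by move=> t; apply: integral_ge0 => y _; exact: mule_ge0.
rewrite (fubini_tonelli _ mGV GV0) /=; apply: eq_integral => y _.
have mhy : measurable_fun setT (fun t : measurableTypeR R => h (expR t *: y)).
  exact: (measurableT_comp mht (pair2_measurable y)).
rewrite -ge0_integralZl // -ge0_integralZr //; first last.
- by move=> t _; exact: mule_ge0.
- exact: emeasurable_funM.
by apply: eq_integral => t _; rewrite /G (muleC (h _)).
Qed.

(** With [h = f |y|^n] the claim is that [ihom] does not change when [h] is composed with the
    inversion. By [ihom_polar] only integrals along rays [expR t *: y] matter, and in the
    logarithmic radius [t] the inversion is the reflection [t |-> b - t]. *)
Lemma ge0_integral_inversion (l : R) f : 0 < l ->
  measurable_fun setT f -> (forall y, 0 <= f y)%E -> f 0 = 0%E ->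
  (\int[mu]_y (f (inversion l y) * ((l / enorm y) ^+ (2 * n))%:E) = \int[mu]_y f y)%E.
Proof.
move=> l0 mf f0 f00.
pose h y := (f y * (enorm y ^+ n)%:E)%E.
have mE k : measurable_fun setT (fun y : 'rV[R]_n => (enorm y ^+ k)%:E).
  by apply/measurable_EFinP; apply: measurable_funX; exact: measurable_enorm.
have h0 y : (0 <= h y)%E by rewrite mule_ge0 // lee_fin exprn_ge0 // enorm_ge0.
have mh : measurable_fun setT h by exact: emeasurable_funM.
have h00 : h 0 = 0%E by rewrite /h f00 mul0e.
have mhi : measurable_fun setT (h \o inversion l).
  exact: (measurableT_comp mh (measurable_inversion l)).
have -> : (\int[mu]_y f y = ihom h)%E.
  apply: eq_integral => y _; have [->|y0] := eqVneq y 0; first by rewrite h00 f00 mul0e.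
  by rewrite /h -muleA -EFinM divff ?mule1 // expf_neq0 // enorm_eq0.
transitivity (ihom (h \o inversion l)).
  apply: eq_integral => y _; have [->|y0] := eqVneq y 0.
    by rewrite /= inversion0 h00 f00 !mul0e.
  rewrite /= /h -muleA -EFinM enorm_inversion; congr (_ * _%:E)%E.
  rewrite exprM -exprVn -exprMn; congr (_ ^+ _).
  by field; rewrite enorm_eq0.
have hi0 : (h \o inversion l) 0 = 0%E by rewrite /= inversion0.
apply: (eq_trans (ihom_polar mhi (fun y => h0 _) hi0)).
apply/esym; apply: (eq_trans (ihom_polar mh h0 h00)); apply/esym.
apply: eq_integral => y _.
suff E : (\int[leb]_t (h \o inversion l) (expR t *: y) = \int[leb]_t h (expR t *: y))%E.
  by rewrite E.
have [->|y0] := eqVneq y 0.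
  by apply: eq_integral => t _ /=; rewrite scaler0 inversion0.
(* Chosen so that [inversion l (expR t *: y) = expR (b - t) *: y]. *)
pose b := ln (l ^+ 2 / enorm y ^+ 2).
have q0 : 0 < l ^+ 2 / enorm y ^+ 2 by rewrite divr_gt0 ?exprn_gt0 // enorm_gt0.
pose k (t : R) := h (expR t *: y).
have mk : measurable_fun setT k.
  apply: (measurableT_comp mh); apply/measurable_fun_rVP => i.
  under eq_fun do rewrite mxE; apply: measurable_funM => //.
have mkb : measurable_fun setT (fun t : R => k (1 * t + b)).
  by apply: (measurableT_comp mk); apply: measurable_funD => //; exact: measurable_funM.
transitivity (\int[leb]_t k (1 * (- t) + b)%R)%E.
  apply: eq_integral => t _; rewrite /= inversion_scaler ?gt_eqF ?expR_gt0 //.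
  by rewrite /k expRD mul1r expRN /b lnK ?posrE // /inversion scalerA.
apply: (eq_trans (ge0_integral_oppr mkb (fun t => h0 _))).
apply: (eq_trans _ (ge0_integral_affine b ltr01 mk (fun t => h0 _))).
by rewrite mul1e.
Qed.

End inversion_formula.

(** * Borel sets and balls *)

Section borel_rV.
Context {R : realType} (n : nat).
Local Notation mu := (lebesgue_measure_rV n).

Lemma measurable_rV_box (A : 'I_n -> set R) : (forall i, measurable (A i)) ->
  measurable [set x : 'rV[R]_n | forall i, A i (x ord0 i)].
Proof.
move=> mA; rewrite (_ : [set x : 'rV[R]_n | _] =
    \bigcap_(i in [set: 'I_n]) [set x : 'rV[R]_n | A i (x ord0 i)]).
  apply: fin_bigcap_measurable => // i _.
  by have := measurable_coord i measurableT (mA i); rewrite setTI.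
by apply/seteqP; split => x /= Ax i; [move=> _|]; exact: Ax.
Qed.

(** Links the product sigma-algebra to the topology: an open set is the union of the countably many
    rational boxes that it contains. *)
Lemma open_measurable_rV (U : set 'rV[R]_n) : open U -> measurable U.
Proof.
move=> oU.
pose box (p : 'rV[rat]_n * rat) := [set x : 'rV[R]_n |
  forall i, `](ratr (p.1 ord0 i) - ratr p.2), (ratr (p.1 ord0 i) + ratr p.2)[%classic (x
    ord0 i)].
pose F p := if `[< box p `<=` U >] then box p else set0.
rewrite (_ : U = \bigcup_p F p).
  apply: countable_bigcupT_measurable => [|p]; first exact: countableP.
  rewrite /F; case: ifP => // _.
  apply: (measurable_rV_box (A := fun i => `](ratr (p.1 ord0 i) - ratr p.2), (ratr (p.1
    ord0 i) + ratr p.2)[%classic)) => i.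
  exact: measurable_itv.
apply/seteqP; split=> [x Ux|x [p _]]; last first.
  by rewrite /F; case: asboolP => // + bpx; exact.
have /nbhs_ballP[e /= e0 eU] : nbhs x U by apply: open_nbhs_nbhs.
(* Points of a box of radius [r] around a centre within [r] of [x] are within [2 r < e] of [x]. *)
have [r] := @rat_in_itvoo R 0 (e / 2) (divr_gt0 e0 (ltr0Sn _ _)).
rewrite in_itv /= => /andP[r0 re].
have qP i : exists q : rat, ratr q \in `](x ord0 i - ratr r), (x ord0 i + ratr r)[.
  have [|q qi] := @rat_in_itvoo R (x ord0 i - ratr r) (x ord0 i + ratr r);
    last by exists q.
  lra.
pose q : 'rV[rat]_n := \row_i xchoose (qP i).
have qxr i : ratr (q ord0 i) \in `](x ord0 i - ratr r), (x ord0 i + ratr r)[.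
  by rewrite mxE; exact: (xchooseP (qP i)).
exists (q, r) => //; rewrite /F asboolT; last first.
  move=> y /= yq; apply: eU; split => // i j; rewrite (ord1 i : i = ord0).
  have := yq j; have := qxr j; rewrite /= !in_itv /= => /andP[h1 h2] /andP[h3 h4].
  by rewrite /ball /= ltr_norml; apply/andP; split; lra.
by move=> i /=; have := qxr i; rewrite !in_itv /= => /andP[h1 h2]; apply/andP; split; lra.
Qed.

(** Lets a function known only to be continuous on an open set be integrated over the whole space
    after extension by zero. *)
Lemma measurable_fun_continuous_in (D : set 'rV[R]_n) (f : 'rV[R]_n -> R) :
  open D -> (forall x, D x -> {for x, continuous f}) ->
  measurable_fun setT (fun x => if `[< D x >] then f x else 0).
Proof.
move=> oD cf; set g := (X in measurable_fun _ X).
rewrite (_ : g = f \_ D); last first.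
  by apply/funext => x; rewrite patchE /g; case: asboolP => Dx;
    [rewrite mem_set|rewrite memNset].
have mD := open_measurable_rV oD.
apply/(measurable_restrictT _ mD) => _; apply: (measurability _ (RGenOpens.measurableE
  R)) => //.
move=> _ [_ [a [b ->]] <-].
apply: open_measurable_rV; rewrite openE => x [Dx fYx]; apply: filterI.
  exact: open_nbhs_nbhs.
by apply: cf => //; apply: open_nbhs_nbhs; split => //; exact: interval_open.
Qed.

End borel_rV.

(** * Volumes of balls, shells and thin sets *)

Section ball_volume.
Context {R : realType} (n : nat).
Local Notation mu := (lebesgue_measure_rV n).

Definition eball (r : R) : set 'rV[R]_n := [set x | enorm x < r].

Lemma open_eball r : open (eball r).
Proof.
exact: (open_comp (f := @enorm R n) (fun x _ => @enorm_continuous R n x) (@open_lt _ r)).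
Qed.

Lemma measurable_eball r : measurable (eball r).
Proof. apply: open_measurable_rV; exact: open_eball. Qed.

Lemma eball_fin r : (mu (eball r) < +oo)%E.
Proof.
pose A (i : 'I_n) : set R := `[(- r), r]%classic.
have mA i : measurable (A i) by exact: measurable_itv.
apply: (@le_lt_trans _ _ (mu [set x : 'rV[R]_n | forall i, A i (x ord0 i)])).
  apply: le_measure; rewrite ?inE; [exact: measurable_eball|exact: measurable_rV_box|].
  move=> x /= xr i; rewrite /A /= in_itv /= -ler_norml.
  exact: (le_trans (coord_le_enorm _ _) (ltW xr)).
rewrite lebesgue_measure_rV_box //.
have Af i : lebesgue_measure (A i) = (fine (lebesgue_measure (A i)))%:E.
  rewrite fineK // /A lebesgue_measure_itv /= lte_fin.
  by case: ifP => _; rewrite ?fin_numD.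
by under eq_bigr do rewrite Af; rewrite prodEFin ltry.
Qed.

Lemma eballZ (c r : R) : 0 < c -> mu (eball (c * r)) = ((c ^+ n)%:E * mu (eball r))%E.
Proof.
move=> c0.
have -> : mu (eball (c * r)) = (\int[mu]_x (\1_(eball (c * r)) x)%:E)%E.
  by rewrite integral_indic ?setIT //; exact: measurable_eball.
rewrite -(ge0_integral_scaler c0); last 2 first.
- by apply/measurable_EFinP/measurable_indic; exact: measurable_eball.
- by move=> x; rewrite lee_fin.
congr (_ * _)%E; rewrite -[eball r]setIT -integral_indic //; last exact: measurable_eball.
apply: eq_integral => x _; rewrite !indicE; congr ((nat_of_bool _)%:R%:E).
apply/idP/idP; rewrite !inE /eball /= enormZ gtr0_norm // ltr_pM2l //.
Qed.

Definition eball_vol : R := fine (mu (eball 1)).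

Lemma eball_vol_ge0 : 0 <= eball_vol.
Proof. by apply: fine_ge0; exact: measure_ge0. Qed.

Lemma eball_measureE (r : R) : 0 < r -> mu (eball r) = (r ^+ n * eball_vol)%:E.
Proof.
move=> r0; rewrite -{1}(mulr1 r) eballZ // EFinM /eball_vol fineK //.
by rewrite ge0_fin_numE ?measure_ge0 // eball_fin.
Qed.

Lemma measurable_annulus (s r : R) : measurable (eball r `\` eball s).
Proof. by apply: measurableD; exact: measurable_eball. Qed.

Lemma annulus_measureE (s r : R) : 0 < s -> s <= r ->
  mu (eball r `\` eball s) = ((r ^+ n - s ^+ n) * eball_vol)%:E.
Proof.
move=> s0 sr; rewrite measureD /=; [|exact: measurable_eball|exact:
  measurable_eball|exact: eball_fin].
rewrite setIidr; last by move=> x; rewrite /eball /= => /lt_le_trans; exact.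
by rewrite !eball_measureE ?(lt_le_trans s0) // -EFinB mulrBl.
Qed.

(** The left side is continuous in [e] and vanishes at [e = 0]. Its terms are the volumes of a slab
    of width [e] and cross-section [M], and of the shell between the radii [l - e] and [l + e]. *)
Lemma small_shell_slab (l d M : R) : 0 < l -> 0 < d ->
  exists2 e, 0 < e < l &
    e * M + ((l + e) ^+ n - (l - e) ^+ n) * eball_vol < d.
Proof.
move=> l0 d0; pose f e : R := e * M + ((l + e) ^+ n - (l - e) ^+ n) * eball_vol.
have cf : {for 0, continuous f}.
  apply: cvgD; first exact: cvgMl.
  apply: cvgMl; apply: cvgB.
    apply: (@continuous_comp _ _ _ (fun e => l + e) (fun x : R => x ^+ n));
      last exact: exprn_continuous.
    by apply: cvgD; [exact: cvg_cst|exact: cvg_id].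
  apply: (@continuous_comp _ _ _ (fun e => l - e) (fun x : R => x ^+ n));
    last exact: exprn_continuous.
  by apply: cvgB; [exact: cvg_cst|exact: cvg_id].
have f0 : f 0 = 0 by rewrite /f mul0r add0r addr0 subr0 subrr mul0r.
have /cf /nbhs_ballP[r /= r0 rf] : nbhs (f 0) (ball (f 0) d) by exact: nbhsx_ballx.
exists (Num.min (r / 2) (l / 2)).
  by rewrite lt_min gt_min; apply/andP; split; [apply/andP; split; lra|apply/orP; right;
    lra].
set e := Num.min _ _.
have e0 : 0 < e by rewrite lt_min; apply/andP; split; lra.
have : ball (f 0) d (f e).
  apply: rf; rewrite /ball /= sub0r normrN gtr0_norm // /e.
  by rewrite gt_min; apply/orP; left; lra.
by rewrite f0 /ball /= sub0r normrN => /ltr_normlW.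
Qed.

Lemma sphere_null (l : R) : 0 < l -> mu [set x : 'rV[R]_n | enorm x = l] = 0%E.
Proof.
move=> l0; set S := [set x | _].
have mS : measurable S.
  rewrite -[S]setTI; exact: (measurable_enorm measurableT (measurable_set1 l)).
apply/eqP; rewrite eq_le measure_ge0 andbT; apply/lee_addgt0Pr => d d0.
have [e /andP[e0 el] eM] := small_shell_slab 0 l0 d0.
rewrite add0e; apply: (@le_trans _ _ (mu (eball (l + e) `\` eball (l - e)))).
  apply: le_measure; rewrite ?inE //; first exact: measurable_annulus.
  by move=> x; rewrite /S /eball /= => ->; split; [lra|apply/negP; rewrite -leNgt; lra].
rewrite annulus_measureE; [|lra|lra].
by rewrite lee_fin ltW //; move: eM; rewrite mulr0 add0r.
Qed.

Lemma small_eball (d : R) : (0 < n)%N -> 0 < d -> exists2 e, 0 < e & (mu (eball e) <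
  d%:E)%E.
Proof.
(* Adding [1] keeps [V] positive and makes the final inequality strict. *)
move=> n0 d0; pose V := eball_vol + 1.
have V0 : 0 < V by rewrite ltr_pwDr // eball_vol_ge0.
exists (Num.min 1 (d / V)); first by rewrite lt_min ltr01 divr_gt0.
set e := Num.min _ _.
have e0 : 0 < e by rewrite lt_min ltr01 divr_gt0.
have e1 : e <= 1 by rewrite ge_min lexx.
have eV : e * V <= d by rewrite -ler_pdivlMr // ge_min lexx orbT.
rewrite eball_measureE // lte_fin; apply: (lt_le_trans _ eV).
have v0 := eball_vol_ge0.
have : e ^+ n * eball_vol <= e * eball_vol.
  by rewrite ler_wpM2r // -{2}(expr1 e) ler_wiXn2l // ltW.
by rewrite /V mulrDr; lra.
Qed.

End ball_volume.

Section half_ball.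
Context {R : realType} (n : nat).
Local Notation mu := (lebesgue_measure_rV n.+1).
Local Notation H := (@halfspace R n.+1).

(** What the half-ball of radius [l + e] has outside the compact core lies in a slab along the
    boundary or in a shell near the sphere. This bounds the defect once the core is known to be free
    of it. *)
Lemma thin_complement (l d : R) : 0 < l -> 0 < d ->
  exists2 e, 0 < e < l & forall A : set 'rV[R]_n.+1, measurable A ->
    (forall y, A y -> [/\ H y, enorm y < l + e & ~ (e <= last_coord y /\ enorm y <= l -
      e)]) ->
    (mu A < d%:E)%E.
Proof.
(* The cross-section of the slab: since [e < l], the other coordinates lie in [[-2 l, 2 l]]. *)
move=> l0 d0; pose M : R := \prod_(i < n.+1 | i != ord_max) (4 * l).
have M0 : 0 <= M by apply: prodr_ge0 => i _; lra.
have [e /andP[e0 el] eM] := @small_shell_slab R n.+1 l d M l0 d0.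
exists e; first by rewrite e0.
move=> A mA hA.
pose K (i : 'I_n.+1) : set R := if i == ord_max then `]0, e[%classic else `[(- (2 * l)),
  (2 * l)]%classic.
have mK i : measurable (K i) by rewrite /K; case: ifP => _; exact: measurable_itv.
pose S := [set x : 'rV[R]_n.+1 | forall i, K i (x ord0 i)].
have mS : measurable S by exact: measurable_rV_box.
have muS : mu S = (e * M)%:E.
  rewrite lebesgue_measure_rV_box // (bigD1 ord_max) //= EFinM.
  rewrite /K eqxx lebesgue_measure_itv /= lte_fin e0 -EFinB subr0; congr (_ * _)%E.
  rewrite /M -prodEFin; apply: eq_bigr => i /negbTE ->.
  rewrite lebesgue_measure_itv /= lte_fin ifT; last lra.
  by rewrite -EFinB; congr EFin; lra.
have sub : A `<=` S `|` (eball (l + e) `\` eball (l - e)).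
  move=> y /hA[Hy yl nQ]; have [yle|yle] := ltP (enorm y) (l - e); last first.
    by right; split => //; apply/negP; rewrite -leNgt.
  left => i; rewrite /K; case: eqP => [->|_] /=; rewrite in_itv /=.
    apply/andP; split => //; rewrite ltNge; apply/negP => h; apply: nQ; split => //.
    exact: ltW.
  rewrite -ler_norml; apply: (le_trans (coord_le_enorm _ _)); lra.
apply: (@le_lt_trans _ _ (mu (S `|` (eball (l + e) `\` eball (l - e))))).
  apply: le_measure => //; rewrite inE //; apply: measurableU => //;
    exact: measurable_annulus.
apply: (@le_lt_trans _ _ (mu S + mu (eball (l + e) `\` eball (l - e)))%E).
  apply: measureU2 => //; exact: measurable_annulus.
by rewrite muS annulus_measureE; [rewrite -EFinD lte_fin|lra|lra].
Qed.

End half_ball.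

(** * The Green's function and its Kelvin transform *)

Section kernel.
Context {R : realType} (n g : nat).
Implicit Types x y : 'rV[R]_n.+1.
Local Notation H := (@halfspace R n.+1).

(** This is [t^(-g/2)], the kernel as a function of the squared distance: reflection, and inversion
    followed by rescaling, change squared distances by an added term. *)
Definition radial (t : R) : R := (Num.sqrt t ^+ g)^-1.

Definition rkernel x : R := (enorm x ^+ g)^-1.

Definition gkernel x y : R := rkernel (x - y) - rkernel (reflect_last x - y).

Lemma rkernelE x : rkernel x = radial (sqnorm x).
Proof. by []. Qed.

Lemma radial_ge0 t : 0 <= radial t.
Proof. by rewrite invr_ge0 exprn_ge0 // sqrtr_ge0. Qed.

Lemma rkernel_ge0 x : 0 <= rkernel x.
Proof. exact: radial_ge0. Qed.

Lemma radial_lt s t : (0 < g)%N -> 0 < s -> s < t -> radial t < radial s.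
Proof.
move=> g0 s0 st; have t0 := lt_trans s0 st.
rewrite /radial ltf_pV2 ?posrE ?exprn_gt0 ?sqrtr_gt0 //.
by rewrite ltrXn2r // ?sqrtr_ge0 // -?lt0n // ltr_sqrt.
Qed.

Lemma radialZ (c t : R) : 0 <= c -> radial (c ^+ 2 * t) = (c ^+ g)^-1 * radial t.
Proof.
by move=> c0; rewrite /radial sqrtrM ?sqr_ge0 // sqrtr_sqr ger0_norm // exprMn invfM.
Qed.

(** A larger gap between larger numbers stays larger after taking powers. This lifts the convexity
    of [t^(-1/2)] to that of [t^(-g/2)]. *)
Lemma subr_expr_lt (k : nat) (a b c d : R) : 0 <= d -> d < b -> d < c ->
  c < a -> c - d < a - b -> c ^+ k.+1 - d ^+ k.+1 < a ^+ k.+1 - b ^+ k.+1.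
Proof.
move=> d0 db dc ca cdab; elim: k => [|k IHk]; first by rewrite !expr1.
have c0 : 0 < c by exact: le_lt_trans dc.
have b0 : 0 < b by exact: le_lt_trans db.
have splitX (x y : R) : x ^+ k.+2 - y ^+ k.+2 =
    x ^+ k.+1 * (x - y) + y * (x ^+ k.+1 - y ^+ k.+1).
  by rewrite !(exprS _ k.+1); ring.
rewrite !splitX; apply: ltr_leD.
  apply: (@lt_le_trans _ _ (c ^+ k.+1 * (a - b))); first by rewrite ltr_pM2l // exprn_gt0.
  rewrite ler_wpM2r //; first by lra.
  by rewrite lerXn2r ?nnegrE; lra.
apply: (@le_trans _ _ (d * (a ^+ k.+1 - b ^+ k.+1))); first by rewrite ler_wpM2l // ltW.
rewrite ler_wpM2r ?(ltW db) // subr_ge0 lerXn2r ?nnegrE; lra.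
Qed.

(** Write [x^-1 - y^-1 = (y^2 - x^2) / ((x + y) x y)]: for square roots both numerators equal [e],
    and the denominator grows with the base point. *)
Lemma invr_sqrt_convex (s d e : R) : 0 < s -> 0 < d -> 0 < e ->
  (Num.sqrt (s + d))^-1 - (Num.sqrt (s + d + e))^-1 <
  (Num.sqrt s)^-1 - (Num.sqrt (s + e))^-1.
Proof.
move=> s0 d0 e0.
have sq (x : R) : 0 < x -> exists2 y : R, 0 < y & x = y ^+ 2.
  by move=> x0; exists (Num.sqrt x); rewrite ?sqrtr_gt0 // sqr_sqrtr // ltW.
have [p p0 pE] := sq _ s0.
have [q q0 qE] := sq (s + e) (addr_gt0 s0 e0).
have [r r0 rE] := sq (s + d) (addr_gt0 s0 d0).
have [t t0 tE] := sq (s + d + e) (addr_gt0 (addr_gt0 s0 d0) e0).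
rewrite tE rE qE pE !sqrtr_sqr !gtr0_norm //.
have pr : p < r by rewrite -(ltr_pXn2r (n := 2)) ?nnegrE ?ltW // -pE -rE; lra.
have qt : q < t by rewrite -(ltr_pXn2r (n := 2)) ?nnegrE ?ltW // -qE -tE; lra.
have pq : p < q by rewrite -(ltr_pXn2r (n := 2)) ?nnegrE ?ltW // -pE -qE; lra.
have rt : r < t by rewrite -(ltr_pXn2r (n := 2)) ?nnegrE ?ltW // -rE -tE; lra.
have dE (x y : R) : 0 < x -> 0 < y -> x^-1 - y^-1 = (y ^+ 2 - x ^+ 2) / ((x + y) * (x *
  y)).
  by move=> x0 y0; field; rewrite !gt_eqF ?addr_gt0.
rewrite !dE // -tE -rE -qE -pE.
have -> : s + d + e - (s + d) = e by ring.
have -> : s + e - s = e by ring.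
rewrite ltr_pM2l // ltf_pV2 ?posrE ?mulr_gt0 ?addr_gt0 //.
by apply: ltr_pM; rewrite ?mulr_ge0 ?addr_ge0 ?(ltW p0) ?(ltW q0) // ?ltr_pM ?(ltW p0)
  ?(ltW q0) //; lra.
Qed.

Lemma radial_convex (s d e : R) : (0 < g)%N -> 0 < s -> 0 < d -> 0 < e ->
  radial (s + d) - radial (s + d + e) < radial s - radial (s + e).
Proof.
rewrite /radial; case: g => // k _ s0 d0 e0; rewrite -!exprVn.
have lt (x y : R) : 0 < x -> x < y -> (Num.sqrt y)^-1 < (Num.sqrt x)^-1.
  move=> x0 xy; have y0 := lt_trans x0 xy.
  by rewrite ltf_pV2 ?posrE ?sqrtr_gt0 // ltr_sqrt.
apply: subr_expr_lt; [|apply: lt; lra|apply: lt; lra|apply: lt;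
  lra|exact: invr_sqrt_convex].
by rewrite invr_ge0 sqrtr_ge0.
Qed.

Lemma halfspaceE x : H x = (0 < x ord0 ord_max).
Proof. by []. Qed.

Lemma reflect_lastE x i :
  reflect_last x ord0 i = if i == ord_max then - x ord0 i else x ord0 i.
Proof. by rewrite mxE. Qed.

Lemma sqnorm_reflect x : sqnorm (reflect_last x) = sqnorm x.
Proof.
apply: eq_bigr => i _; rewrite reflect_lastE; case: ifP => _ //.
by rewrite sqrrN.
Qed.

Lemma enorm_reflect x : enorm (reflect_last x) = enorm x.
Proof. by rewrite !enormE sqnorm_reflect. Qed.

Lemma reflectZ (c : R) x : reflect_last (c *: x) = c *: reflect_last x.
Proof. by apply/rowP => i; rewrite !mxE; case: ifP; rewrite ?mulrN. Qed.

Lemma inversion_reflect l x : reflect_last (inversion l x) = inversion l (reflect_last x).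
Proof. by rewrite /inversion reflectZ enorm_reflect. Qed.

Lemma dotp_reflect x y :
  dotp (reflect_last x) y = dotp x y - 2 * (last_coord x * last_coord y).
Proof.
rewrite /dotp (bigD1 ord_max) //= [in RHS](bigD1 ord_max) //= reflect_lastE eqxx.
rewrite (eq_bigr (fun i => x ord0 i * y ord0 i)); first ring.
by move=> i /negbTE ni; rewrite reflect_lastE ni.
Qed.

Lemma sqnorm_reflectB x y :
  sqnorm (reflect_last x - y) = sqnorm (x - y) + 4 * (last_coord x * last_coord y).
Proof. by rewrite !sqnormB sqnorm_reflect dotp_reflect; ring. Qed.

Lemma sqnorm_gt0 x : (0 < sqnorm x) = (x != 0).
Proof. by rewrite -sqrtr_gt0 -enormE enorm_gt0. Qed.

Lemma halfspace_neq0 x : H x -> x != 0.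
Proof. by rewrite halfspaceE; apply: contraTneq => ->; rewrite mxE ltxx. Qed.

Lemma halfspaceZ (c : R) x : 0 < c -> H (c *: x) = H x.
Proof. by move=> c0; rewrite !halfspaceE mxE pmulr_rgt0. Qed.

Lemma halfspace_inversion l x : l != 0 -> H (inversion l x) = H x.
Proof.
move=> l0; have [->|x0] := eqVneq x 0; first by rewrite inversion0.
by rewrite halfspaceZ // divr_gt0 // exprn_even_gt0 //= enorm_eq0.
Qed.

Lemma gkernelE x y : gkernel x y =
  radial (sqnorm (x - y)) - radial (sqnorm (x - y) + 4 * (last_coord x * last_coord y)).
Proof. by rewrite /gkernel !rkernelE sqnorm_reflectB. Qed.

Lemma gkernel_le x y : gkernel x y <= rkernel (x - y).
Proof. by rewrite lerBlDr lerDl rkernel_ge0. Qed.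

Lemma gkernel_gt0 x y : (0 < g)%N -> H x -> H y -> x != y -> 0 < gkernel x y.
Proof.
move=> g0 Hx Hy xy; rewrite gkernelE subr_gt0 radial_lt //.
  by rewrite sqnorm_gt0 subr_eq0.
by rewrite ltrDl mulr_gt0 // mulr_gt0.
Qed.

Lemma gkernelZ (c : R) x y : 0 < c -> gkernel (c *: x) (c *: y) = (c ^+ g)^-1 * gkernel x
  y.
Proof.
move=> c0; rewrite /gkernel reflectZ -!scalerBr /rkernel !enormZ (gtr0_norm c0).
by rewrite !exprMn !invfM mulrBr.
Qed.

Lemma enorm_inversionB l x y : x != 0 -> y != 0 ->
  enorm (inversion l x - inversion l y) = l ^+ 2 / (enorm x * enorm y) * enorm (x - y).
Proof.
move=> x0 y0; have nx : enorm x != 0 by rewrite enorm_eq0.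
have ny : enorm y != 0 by rewrite enorm_eq0.
have c0 : 0 <= l ^+ 2 / (enorm x * enorm y).
  by rewrite divr_ge0 ?sqr_ge0 // mulr_ge0 ?enorm_ge0.
rewrite -[X in X * _](ger0_norm c0) -enormZ [LHS]enormE [RHS]enormE; congr Num.sqrt.
rewrite sqnormZ !sqnormB /inversion !sqnormZ dotpZl dotpZr.
by rewrite -!sqr_enorm; field; rewrite nx ny.
Qed.

Lemma rkernel_inversion l x y : l != 0 -> x != 0 -> y != 0 ->
  rkernel (inversion l x - inversion l y) =
  (enorm x * enorm y / l ^+ 2) ^+ g * rkernel (x - y).
Proof.
move=> l0 x0 y0; rewrite /rkernel enorm_inversionB // exprMn invfM; congr (_ * _).
by rewrite -exprVn invf_div.
Qed.

Lemma gkernel_inversion l x y : l != 0 -> x != 0 -> y != 0 ->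
  gkernel (inversion l x) (inversion l y) =
  (enorm x * enorm y / l ^+ 2) ^+ g * gkernel x y.
Proof.
move=> l0 x0 y0; rewrite /gkernel inversion_reflect !rkernel_inversion //.
  by rewrite enorm_reflect mulrBr.
by rewrite -enorm_eq0 enorm_reflect enorm_eq0.
Qed.

Definition kelvin_kernel l x y : R := (l / enorm x) ^+ g * gkernel (inversion l x) y.

(** The transform may act on either variable. This symmetry is what lets the part of the integral
    outside the ball be rewritten with the same kernel. *)
Lemma kelvin_kernelE l x y : l != 0 -> x != 0 -> y != 0 ->
  kelvin_kernel l x y = (l / enorm y) ^+ g * gkernel x (inversion l y).
Proof.
move=> l0 x0 y0; rewrite /kelvin_kernel -{1}(inversionK l0 y) gkernel_inversion //.
  rewrite mulrA -exprMn enorm_inversion; congr (_ ^+ _ * _).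
  by field; rewrite !enorm_eq0 l0 x0 y0.
by rewrite inversion_eq0.
Qed.

(** The added term is positive when [x] and [y] are both inside the sphere, so inversion, once
    rescaled, moves [x] away from [y]. *)
Lemma sqnorm_inversionB l x y : l != 0 -> x != 0 ->
  (enorm x / l) ^+ 2 * sqnorm (inversion l x - y) =
  sqnorm (x - y) + (l ^+ 2 - enorm x ^+ 2) * (l ^+ 2 - enorm y ^+ 2) / l ^+ 2.
Proof.
move=> l0 x0; rewrite !sqnormB /inversion sqnormZ dotpZl -!sqr_enorm; field.
by rewrite l0 enorm_eq0 x0.
Qed.

Lemma kelvin_kernel_radial l x y : 0 < l -> x != 0 ->
  let D := (l ^+ 2 - enorm x ^+ 2) * (l ^+ 2 - enorm y ^+ 2) / l ^+ 2 in
  kelvin_kernel l x y = radial (sqnorm (x - y) + D) -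
    radial (sqnorm (x - y) + D + 4 * (last_coord x * last_coord y)).
Proof.
move=> l0 x0 D; have q0 : 0 <= enorm x / l by rewrite divr_ge0 ?enorm_ge0 // ltW.
rewrite /kelvin_kernel /gkernel mulrBr -[l / _]invf_div exprVn !rkernelE.
have ln0 : l != 0 by rewrite gt_eqF.
have rx0 : reflect_last x != 0 by rewrite -enorm_eq0 enorm_reflect enorm_eq0.
(* The added term sees [x] only through [enorm x], so the reflected point gets the same shift
   [D]. *)
have E := sqnorm_inversionB y ln0 rx0; rewrite enorm_reflect in E.
rewrite -!radialZ // inversion_reflect sqnorm_inversionB // E.
by rewrite sqnorm_reflectB -/D addrAC.
Qed.

(** Strict convexity of [radial], with base point [|x - y|^2], shift [D > 0] and increment
    [4 x_n y_n > 0]. *)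
Lemma kelvin_kernel_lt l x y : (0 < g)%N -> 0 < l -> H x -> H y -> enorm x < l -> enorm y
  < l ->
  x != y -> kelvin_kernel l x y < gkernel x y.
Proof.
move=> g0 l0 Hx Hy xl yl xy; rewrite kelvin_kernel_radial ?halfspace_neq0 // gkernelE.
apply: radial_convex => //.
- by rewrite sqnorm_gt0 subr_eq0.
- by rewrite divr_gt0 ?exprn_gt0 // mulr_gt0 // subr_gt0 ltrXn2r ?enorm_ge0 // ltW.
- by rewrite mulr_gt0 // mulr_gt0.
Qed.

Lemma measurable_rkernelB x : measurable_fun setT (fun y => rkernel (x - y)).
Proof.
apply: (measurableT_comp (@measurable_enormVX R n.+1 g)); apply/measurable_fun_rVP => i.
under eq_fun do rewrite !mxE; apply: measurable_funB => //; exact: measurable_coord.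
Qed.

Lemma measurable_gkernel x : measurable_fun setT (gkernel x).
Proof. by apply: measurable_funB; exact: measurable_rkernelB. Qed.

Lemma measurable_last_coord : measurable_fun setT (@last_coord R n.+1).
Proof. exact: measurable_coord. Qed.

Lemma last_coord_continuous : continuous (@last_coord R n.+1).
Proof. by move=> x; exact: coord_continuous. Qed.

Lemma open_halfspace : open H.
Proof.
exact: (open_comp (f := @last_coord R n.+1) (fun x _ => @last_coord_continuous x)
  (@open_gt _ 0)).
Qed.

Lemma measurable_halfspace : measurable H.
Proof. by apply: open_measurable_rV; exact: open_halfspace. Qed.

End kernel.

(** * Uniform integrability of the singular weight *)

Section singular_weight_1d.
Context {R : realType}.
Local Notation leb := (@lebesgue_measure R).

Lemma measurable_powR_comp d (T : measurableType d) (D : set T) (f : T -> R) (k : R) :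
  measurable_fun D f -> measurable_fun D (fun x => f x `^ k).
Proof. by move=> mf; exact: (measurableT_comp (measurable_powR k) mf). Qed.

Lemma continuous_powR (k x : R) : 0 < x -> {for x, continuous (fun s : R => s `^ k)}.
Proof.
move=> x0; apply/differentiable_continuous/derivable1_diffP.
by apply: derivable_powR; rewrite in_itv /= andbT.
Qed.

(** The bound does not involve [e], so it survives exhausting []0, T]] by such intervals. *)
Lemma integral_powRN_le (k e T : R) : k < 1 -> 0 < e -> e < T ->
  (\int[leb]_(s in `[e, T]) (s `^ (- k))%:E <= (T `^ (1 - k) / (1 - k))%:E)%E.
Proof.
move=> k1 e0 eT; have k0 : 0 < 1 - k by rewrite subr_gt0.
pose F (s : R) := (1 - k)^-1 * s `^ (1 - k).
have cF x : 0 < x -> {for x, continuous F}.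
  by move=> x0; apply: cvgMr; exact: continuous_powR.
rewrite (@continuous_FTC2 _ (fun s => s `^ (- k)) F) //.
- rewrite /F -EFinB lee_fin mulrC lerBlDr lerDl.
  by rewrite mulr_ge0 ?powR_ge0 // invr_ge0 ltW.
- apply: continuous_in_subspaceT => x; rewrite inE /= in_itv /= => /andP[ex _].
  by apply: continuous_powR; exact: lt_le_trans ex.
- split.
  + move=> x; rewrite in_itv /= => /andP[ex _]; apply: derivableM => //.
    by apply: derivable_powR; rewrite in_itv /= andbT (lt_trans e0 ex).
  + by apply: cvg_at_right_filter; exact: cF.
  + by apply: cvg_at_left_filter; apply: cF; exact: lt_trans eT.
- move=> x; rewrite in_itv /= => /andP[ex _]; have x0 := lt_trans e0 ex.
  rewrite derive1E deriveZ /=; last first.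
    by apply: derivable_powR; rewrite in_itv /= andbT.
  rewrite -derive1E powR_derive1 ?in_itv /= ?andbT //.
  rewrite /GRing.scale /= mulrA mulVf ?mul1r ?gt_eqF //.
  by congr (_ `^ _); ring.
Qed.

Lemma integral_powRN_le0 (k T : R) : k < 1 -> 0 < T ->
  (\int[leb]_(s in `]0%R, T]) (s `^ (- k))%:E <= (T `^ (1 - k) / (1 - k))%:E)%E.
Proof.
(* With [i.+2] the left endpoint is strictly below [T], already for [i = 0]. *)
move=> k1 T0; pose F (i : nat) : set R := `[T / i.+2%:R, T]%classic.
have mF i : measurable (F i) by exact: measurable_itv.
have mp (D : set R) : measurable_fun D (fun s : R => (s `^ (- k))%:E).
  by apply/measurable_EFinP; apply: measurable_powR_comp.
have -> : `]0, T]%classic = \bigcup_i F i.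
  apply/seteqP; split=> [s|s [i _]]; rewrite /F /= !in_itv /=; last first.
    by move=> /andP[h1 ->]; rewrite andbT (lt_le_trans _ h1) // divr_gt0.
  move=> /andP[s0 sT]; have Ts : 0 <= T / s by rewrite divr_ge0 // ltW.
  exists (Num.truncn (T / s)) => //=; rewrite in_itv /= sT andbT.
  rewrite ler_pdivrMr // mulrC -ler_pdivrMr //.
  apply: (le_trans (ltW (truncnS_gt _))) => //.
  by rewrite ler_nat.
have nF : nondecreasing_seq F.
  move=> i j ij; rewrite subsetEset => s; rewrite /F /= !in_itv /= => /andP[h ->].
  rewrite andbT; apply: (le_trans _ h); rewrite ler_pM2l // lef_pV2 ?posrE //.
  by rewrite ler_nat !ltnS.
have p0 (i : nat) (s : measurableTypeR R) : F i s -> (0 <= (s `^ (- k))%:E)%E.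
  by rewrite lee_fin powR_ge0.
have mpF i : measurable_fun (F i : set (measurableTypeR R)) (fun s : R => (s `^ (-
  k))%:E).
  exact: mp.
have /cvg_lim <- // := ge0_nondecreasing_set_cvg_integral (mu := leb) nF mF mpF p0.
apply: lime_le.
  apply: ereal_nondecreasing_is_cvgn.
  exact: (ge0_nondecreasing_set_nondecreasing_integral leb nF mF mpF p0).
apply: nearW => i; apply: integral_powRN_le => //; first by rewrite divr_gt0.
by rewrite ltr_pdivrMr // ltr_pMr // ltr1n.
Qed.

Let cutoff (L k s : R) : R := \1_`[(- L), L] s * `|s| `^ (- k).

Let cutoff_ge0 L k s : 0 <= cutoff L k s.
Proof. by rewrite mulr_ge0 // powR_ge0. Qed.

Let measurable_cutoff L k : measurable_fun setT (cutoff L k).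
Proof.
apply: measurable_funM; last by apply: measurable_powR_comp; exact: normr_measurable.
by apply: measurable_indic; exact: measurable_itv.
Qed.

Let integral_cutoff L k : 0 < L -> 0 < k -> k < 1 ->
  (\int[leb]_s (cutoff L k s)%:E <= (2 * (L `^ (1 - k) / (1 - k)))%:E)%E.
Proof.
move=> L0 k0 k1; pose phi (s : R) : R := \1_`]0, L] s * s `^ (- k).
have phi0 s : 0 <= phi s by rewrite mulr_ge0 // powR_ge0.
have mphi : measurable_fun setT phi.
  apply: measurable_funM; last exact: measurable_powR_comp.
  by apply: measurable_indic; exact: measurable_itv.
have mEphi : measurable_fun setT (EFin \o phi) by exact/measurable_EFinP.
have mEphiN : measurable_fun setT (fun s : R => (phi (- s))%:E).
  by apply/measurable_EFinP; apply: (measurableT_comp mphi).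
have Iphi : (\int[leb]_s (phi s)%:E <= (L `^ (1 - k) / (1 - k))%:E)%E.
  apply: le_trans (integral_powRN_le0 k1 L0).
  rewrite [leRHS]integral_mkcond; apply: ge0_le_integral => //.
  - by move=> s _; rewrite lee_fin.
  - have mI : measurable (`]0, L]%classic :
    set (measurableTypeR R)) by exact: measurable_itv.
    apply/(measurable_restrictT _ mI).
    by apply/measurable_EFinP; exact: measurable_powR_comp.
  - by move=> s _; rewrite patchE /phi indicE; case: ifP => _; rewrite ?mul1r ?mul0r.
apply: (@le_trans _ _ (\int[leb]_s ((phi s)%:E + (phi (- s))%:E)))%E.
  apply: ge0_le_integral => //.
  - by move=> s _; rewrite lee_fin.
  - by apply/measurable_EFinP; exact: measurable_cutoff.
  - exact: emeasurable_funD.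
  move=> s _; rewrite -EFinD lee_fin /cutoff /phi !indicE !mem_setE !in_itv /=.
  have [s0|s0|<-] := ltgtP 0 s; last 1 first.
  (* At [s = 0] the negative power has the default value [0]. *)
  - rewrite normr0 powR0 ?oppr_eq0 ?gt_eqF // mulr0.
    by rewrite addr_ge0 // mulr_ge0 ?powR_ge0.
  - rewrite gtr0_norm // (_ : - L <= s); last lra.
    by rewrite /= lerDl mulr_ge0 ?powR_ge0.
  - rewrite ltr0_norm // oppr_gt0 s0 (_ : s <= L); last lra.
    by rewrite andbT lerNl /= mul0r add0r.
rewrite ge0_integralD //; last 2 first.
- by move=> s _; rewrite lee_fin.
- by move=> s _; rewrite lee_fin.
rewrite (ge0_integral_oppr mEphi) //.
by rewrite mulr_natl mulr2n EFinD; exact: leeD.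
Qed.

(** A common majorant for all coordinates: [|x - s|^(-k)] is the singularity of the kernel,
    [|s|^(-k)] that of the weight at the boundary, and [1] covers distances above [1]. *)
Definition cutoff_weight (L k x s : R) : R :=
  \1_`[(- L), L] s * (1 + `|x - s| `^ (- k) + `|s| `^ (- k)).

Lemma cutoff_weight_ge0 L k x s : 0 <= cutoff_weight L k x s.
Proof. by rewrite mulr_ge0 // !addr_ge0 // powR_ge0. Qed.

Lemma measurable_cutoff_weight L k x : measurable_fun setT (cutoff_weight L k x).
Proof.
apply: measurable_funM; first by apply: measurable_indic; exact: measurable_itv.
apply: measurable_funD; last by apply: measurable_powR_comp; exact: normr_measurable.
apply: measurable_funD => //; apply: measurable_powR_comp.
by apply: measurableT_comp => //; exact: measurable_funB.
Qed.

Lemma integral_cutoff_weight L k : 0 < L -> 0 < k -> k < 1 ->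
  exists2 M : R, 0 <= M & forall x, `|x| <= L ->
    (\int[leb]_s (cutoff_weight L k x s)%:E <= M%:E)%E.
Proof.
move=> L0 k0 k1; pose C (T : R) := 2 * (T `^ (1 - k) / (1 - k)).
have C0 T : 0 <= C T by rewrite mulr_ge0 // divr_ge0 ?powR_ge0 // subr_ge0 ltW.
(* One term for each summand of the weight; the middle one has [2 * L] because
   [|x - s| <= 2 * L]. *)
exists (2 * L + C (2 * L) + C L); first by rewrite !addr_ge0 // mulr_ge0 // ltW.
move=> x; rewrite ler_norml => /andP[x1 x2].
have mC T : measurable_fun setT (fun s : R => (cutoff T k s)%:E).
  by apply/measurable_EFinP; exact: measurable_cutoff.
have C0' T (s : R) : (0 <= (cutoff T k s)%:E)%E by rewrite lee_fin.
have mCx : measurable_fun setT (fun s : R => (cutoff (2 * L) k (1 * s + x))%:E).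
  apply: (measurableT_comp (mC _)); apply: measurable_funD => //; exact: measurable_funM.
have mCNx : measurable_fun setT (fun s : R => (cutoff (2 * L) k (1 * (- s) + x))%:E).
  exact: (measurableT_comp mCx).
have mi : measurable_fun setT (fun s : R => (\1_`[(- L), L] s : R)%:E).
  by apply/measurable_EFinP/measurable_indic; exact: measurable_itv.
have i0 (s : R) : (0 <= (\1_`[(- L), L] s : R)%:E)%E by rewrite lee_fin.
apply: (@le_trans _ _ (\int[leb]_s ((\1_`[(- L), L] s : R)%:E
   + (cutoff (2 * L) k (1 * (- s) + x))%:E + (cutoff L k s)%:E)))%E.
  apply: ge0_le_integral => //.
  - by move=> s _; rewrite lee_fin cutoff_weight_ge0.
  - by apply/measurable_EFinP; exact: measurable_cutoff_weight.
  - by apply: emeasurable_funD; [exact: emeasurable_funD|exact: mC].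
  move=> s _; rewrite -!EFinD lee_fin /cutoff_weight /cutoff !indicE !mem_setE !in_itv /=.
  have [/andP[s1 s2]|_] := boolP (- L <= s <= L); last first.
    by rewrite !mul0r add0r addr0 mulr_ge0 ?powR_ge0.
  rewrite !mul1r (_ : - s + x = x - s); last by rewrite addrC.
  rewrite (_ : - (2 * L) <= x - s <= 2 * L) ?mul1r //.
  by apply/andP; split; lra.
rewrite ge0_integralD; [|exact: measurableT|by move=> s _; exact: adde_ge0|
  exact: emeasurable_funD|by move=> s _; exact: C0'|exact: mC].
rewrite ge0_integralD //.
rewrite !EFinD; apply: leeD; last exact: integral_cutoff.
apply: leeD.
  have mI : measurable (`[(- L), L]%classic :
    set (measurableTypeR R)) by exact: measurable_itv.
  rewrite [leLHS](integral_indic leb measurableT mI) setIT.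
  rewrite [leLHS](lebesgue_measure_itv (Interval (BLeft (- L)) (BRight L))) /= lte_fin.
  by case: ifP => _; rewrite ?lee_fin ?mulr_ge0 // -?EFinB ?lee_fin; lra.
apply: (le_trans _ (integral_cutoff _ k0 k1)); last by rewrite mulr_gt0.
have := ge0_integral_oppr mCx (fun s => C0' _ _).
have := ge0_integral_affine x ltr01 (mC (2 * L)) (fun s => C0' _ _).
by rewrite mul1e => <- ->.
Qed.

End singular_weight_1d.

Section uniform_smallness.
Context {R : realType} (n g : nat).
Implicit Types x y : 'rV[R]_n.+1.
Local Notation mu := (lebesgue_measure_rV n.+1).
Local Notation H := (@halfspace R n.+1).
Local Notation eball := (@eball R n.+1).

Lemma powR_prod (I : Type) (r : seq I) (F : I -> R) (k : R) : (forall i, 0 <= F i) ->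
  (\prod_(i <- r) F i) `^ k = \prod_(i <- r) F i `^ k.
Proof.
move=> F0; elim: r => [|i r IHr]; first by rewrite !big_nil powR1.
by rewrite !big_cons powRM ?IHr // prodr_ge0.
Qed.

Lemma prod_coord_le_enorm x : \prod_i `|x ord0 i| <= enorm x ^+ n.+1.
Proof.
rewrite -[X in _ ^+ X]card_ord -prodr_const.
by apply: ler_prod => i _; rewrite normr_ge0 coord_le_enorm.
Qed.

(** The product is at most [min t s] to the power [- (a + b)]. In the last coordinate this merges
    the singularities of kernel and weight. *)
Lemma powR_le_max (t s a b : R) : 0 < t -> 0 < s -> 0 <= a -> 0 <= b ->
  t `^ (- a) * s `^ (- b) <= t `^ (- (a + b)) + s `^ (- (a + b)).
Proof.
move=> t0 s0 a0 b0.
have antitone (c u v : R) : 0 <= c -> 0 < u -> u <= v -> v `^ (- c) <= u `^ (- c).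
  move=> c0 u0 uv; rewrite !powRN lef_pV2 ?posrE ?powR_gt0 //.
    by rewrite ge0_ler_powR // nnegrE ltW // (lt_le_trans u0).
  exact: lt_le_trans uv.
rewrite !opprD !powRD ?(gt_eqF t0) ?(gt_eqF s0) ?implybT //.
have [ts|/ltW st] := leP t s.
  apply: (@le_trans _ _ (t `^ (- a) * t `^ (- b)));
    last by rewrite lerDl mulr_ge0 ?powR_ge0.
  by rewrite ler_wpM2l ?powR_ge0 // antitone.
apply: (@le_trans _ _ (s `^ (- a) * s `^ (- b))); last by rewrite lerDr mulr_ge0
  ?powR_ge0.
by rewrite ler_wpM2r ?powR_ge0 // antitone.
Qed.

Lemma powRN_le_1D (t a b : R) : 0 < t -> 0 <= a -> a <= b -> t `^ (- a) <= 1 + t `^ (- b).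
Proof.
move=> t0 a0 ab; have [t1|/ltW t1] := leP t 1.
  by rewrite ler_wpDl // ger_powR ?t0 // lerN2.
rewrite ler_wpDr ?powR_ge0 // -(powRr0 t).
by apply: ler_powR => //; rewrite oppr_le0.
Qed.

Definition weight (a : R) x y : R := rkernel g (x - y) * last_coord y `^ a.

Lemma weight_ge0 a x y : 0 <= weight a x y.
Proof. by rewrite mulr_ge0 ?rkernel_ge0 ?powR_ge0. Qed.

Lemma measurable_weight a x : measurable_fun setT (weight a x).
Proof.
apply: measurable_funM; first exact: measurable_rkernelB.
by apply: measurable_powR_comp; exact: measurable_last_coord.
Qed.

(* [|x - y|] dominates the geometric mean of the [|x_i - y_i|], so the weight
   is bounded by a product of functions of one coordinate. *)
Lemma weight_powR_le (a r L : R) : (0 < g)%N -> 0 < r -> 0 < L ->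
  let t := r * (g%:R / n.+1%:R) in let b := r * Num.max 0 (- a) in
  exists2 c : R, 0 <= c & forall x y, H y -> enorm y < L ->
    (forall i, y ord0 i != x ord0 i) ->
    weight a x y `^ r <= c * \prod_i cutoff_weight L (t + b) (x ord0 i) (y ord0 i).
Proof.
move=> g0 r0 L0 t b.
have t0 : 0 <= t by rewrite mulr_ge0 ?divr_ge0 // ltW.
have b0 : 0 <= b by rewrite mulr_ge0 ?le_max ?lexx // ltW.
(* The [1] serves [a < 0]; for [a >= 0] the weight has no singularity and [L ^ (a r)] bounds it. *)
exists (1 + L `^ (a * r)); first by rewrite addr_ge0 ?powR_ge0.
move=> x y Hy yL yx.
have yn0 : 0 < last_coord y by exact: Hy.
have ynL : last_coord y <= L.
  by apply: (le_trans (ler_norm _)); exact: (le_trans (coord_le_enorm _ _) (ltW yL)).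
have d0 i : 0 < `|x ord0 i - y ord0 i| by rewrite normr_gt0 subr_eq0 eq_sym.
rewrite /weight powRM ?rkernel_ge0 ?powR_ge0 //.
have dxy : 0 < enorm (x - y).
  by rewrite enorm_gt0 subr_eq0; apply: contraNneq (yx ord0) => ->.
have hker : rkernel g (x - y) `^ r <= \prod_i `|x ord0 i - y ord0 i| `^ (- t).
  rewrite -powR_prod //.
  set P := \prod_i _; have P0 : 0 < P by apply: prodr_gt0 => i _.
  have PE : P <= enorm (x - y) ^+ n.+1.
    by have := prod_coord_le_enorm (x - y); under eq_bigr do rewrite !mxE.
  rewrite /rkernel -powR_mulrn ?enorm_ge0 // -powRN -powRrM mulNr !powRN.
  rewrite lef_pV2 ?posrE ?powR_gt0 //.
  have -> : enorm (x - y) `^ (g%:R * r) = (enorm (x - y) ^+ n.+1) `^ t.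
    rewrite -powR_mulrn ?enorm_ge0 // -powRrM; congr (_ `^ _).
    by rewrite /t; field.
  by rewrite ge0_ler_powR // nnegrE ?ltW // exprn_gt0.
have hlast : (last_coord y `^ a) `^ r <= (1 + L `^ (a * r)) * last_coord y `^ (- b).
  rewrite -powRrM /b; have [a0|a0] := leP 0 a.
    rewrite (max_idPl _) ?oppr_le0 // mulr0 oppr0 powRr0 mulr1.
    rewrite ler_wpDl // ge0_ler_powR ?mulr_ge0 ?nnegrE // ltW //.
  rewrite (max_idPr _) ?oppr_ge0 ?(ltW a0) // mulrN opprK (mulrC r).
  by rewrite mulrDl mul1r lerDl mulr_ge0 ?powR_ge0.
apply: (le_trans (ler_pM (powR_ge0 _ _) (powR_ge0 _ _) hker hlast)).
rewrite mulrCA ler_wpM2l ?addr_ge0 ?powR_ge0 //.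
(* Only the last coordinate carries both singularities; in the others the exponent is merely raised
   from [t] to [t + b]. *)
rewrite (bigD1 ord_max) //= [leRHS](bigD1 ord_max) //= mulrAC.
have inL i : \1_`[(- L), L] (y ord0 i) = 1 :> R.
  rewrite indicE mem_setE in_itv /= -ler_norml.
  by rewrite (le_trans (coord_le_enorm _ _) (ltW yL)).
apply: ler_pM.
- by rewrite mulr_ge0 ?powR_ge0.
- by apply: prodr_ge0 => i _; exact: powR_ge0.
- rewrite /cutoff_weight inL mul1r.
  apply: (le_trans (powR_le_max (d0 _) yn0 t0 b0)).
  by rewrite [last_coord y]/= (gtr0_norm yn0) -addrA ler_wpDl.
- apply: ler_prod => i _; rewrite powR_ge0 /cutoff_weight inL mul1r.
  rewrite ler_wpDr ?powR_ge0 //; apply: powRN_le_1D => //.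
  by rewrite lerDl.
Qed.

Lemma ae_coord_neq x : {ae mu, forall y, forall i, y ord0 i != x ord0 i}.
Proof.
suff h i : {ae mu, forall y : 'rV[R]_n.+1, y ord0 i != x ord0 i} by exact: filter_forall.
exists [set y : 'rV[R]_n.+1 | y ord0 i = x ord0 i]; split.
- exact: measurable_rV_coord.
- exact: lebesgue_measure_rV_coord.
- by move=> y /= /negP; rewrite negbK => /eqP.
Qed.

Lemma measurable_half_ball (L : R) : measurable (H `&` eball L).
Proof. by apply: measurableI; [exact: measurable_halfspace|exact: measurable_eball]. Qed.

(** The assumed inequality says that each coordinate of the product bound has a singularity of
    exponent below [1], which is integrable uniformly in [x]. *)
Lemma integral_weight_powR (a r L : R) : (0 < g)%N -> 0 < r -> 0 < L ->
  r * (g%:R / n.+1%:R) + r * Num.max 0 (- a) < 1 ->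
  exists2 M : R, 0 <= M & forall x, enorm x < L ->
    (\int[mu]_(y in H `&` eball L) (weight a x y `^ r)%:E <= M%:E)%E.
Proof.
move=> g0 r0 L0; set k := (X in X < 1) => k1.
have k0 : 0 < k.
  by rewrite ltr_pwDl ?mulr_gt0 ?divr_gt0 ?ltr0n // ?mulr_ge0 ?le_max ?lexx // ltW.
have [c c0 hc] := weight_powR_le a g0 r0 L0.
have [M M0 hM] := integral_cutoff_weight L0 k0 k1.
exists (c * M ^+ n.+1); first by rewrite mulr_ge0 // exprn_ge0.
move=> x xL; pose w y := \prod_i cutoff_weight L k (x ord0 i) (y ord0 i).
have w0 y : 0 <= w y by apply: prodr_ge0 => i _; exact: cutoff_weight_ge0.
have mw : measurable_fun setT (fun y => (c * w y)%:E).
  apply/measurable_EFinP; apply: measurable_funM => //; apply: measurable_prod => i _.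
  exact: (measurableT_comp (measurable_cutoff_weight L k _) (measurable_coord i)).
apply: (@le_trans _ _ (\int[mu]_(y in H `&` eball L) (c * w y)%:E)%E).
  apply: ae_ge0_le_integral.
  - exact: measurable_half_ball.
  - by move=> y _; rewrite lee_fin powR_ge0.
  - apply/measurable_EFinP; apply: measurable_powR_comp.
    by apply: measurable_funTS; exact: measurable_weight.
  - by move=> y _; rewrite lee_fin mulr_ge0.
  - exact: measurable_funTS.
  - apply: filterS (ae_coord_neq x) => y yx [Hy yL]; rewrite lee_fin; exact: hc.
apply: (@le_trans _ _ (\int[mu]_y (c * w y)%:E)%E).
  apply: ge0_subset_integral => //; first exact: measurable_half_ball.
  by move=> y _; rewrite lee_fin mulr_ge0.
under eq_integral do rewrite EFinM.
rewrite ge0_integralZl_EFin //; last 2 first.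
- by move=> y _; rewrite lee_fin.
- apply/measurable_EFinP; apply: measurable_prod => i _.
  exact: (measurableT_comp (measurable_cutoff_weight L k _) (measurable_coord i)).
rewrite EFinM lee_wpmul2l ?lee_fin //.
rewrite (ge0_integral_prod_coord (k := fun i => cutoff_weight L k (x ord0 i)));
  last 2 first.
- by move=> i; exact: measurable_cutoff_weight.
- by move=> i s; exact: cutoff_weight_ge0.
pose J i := fine (\int[lebesgue_measure]_s (cutoff_weight L k (x ord0 i) s)%:E)%E.
have I0 i : (0 <= \int[lebesgue_measure]_s (cutoff_weight L k (x ord0 i) s)%:E)%E.
  by apply: integral_ge0 => s _; rewrite lee_fin cutoff_weight_ge0.
have IM i : (\int[lebesgue_measure]_s (cutoff_weight L k (x ord0 i) s)%:E <= M%:E)%E.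
  by apply: hM; exact: (le_trans (coord_le_enorm _ _) (ltW xL)).
have JE i : (\int[lebesgue_measure]_s (cutoff_weight L k (x ord0 i) s)%:E = (J i)%:E)%E.
  by rewrite fineK // ge0_fin_numE // (le_lt_trans (IM i)) // ltry.
under eq_bigr do rewrite JE.
rewrite prodEFin lee_fin -[X in _ ^+ X]card_ord -prodr_const.
apply: ler_prod => i _; rewrite -!lee_fin -JE; apply/andP; split; first exact: I0.
exact: IM.
Qed.

(** A uniform bound on the integral of the power [r > 1] gives uniform integrability: the weight [w]
    satisfies [w <= T + T^(1-r) w^r] at every height [T > 0]. *)
Lemma integral_weight_small (a L e : R) : (0 < g)%N -> 0 < L -> 0 < e ->
  g%:R / n.+1%:R + Num.max 0 (- a) < 1 ->
  exists2 d : R, 0 < d & forall x (A : set 'rV[R]_n.+1), enorm x < L -> measurable A ->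
    A `<=` H `&` eball L -> (mu A < d%:E)%E ->
    (\int[mu]_(y in A) (weight a x y)%:E <= e%:E)%E.
Proof.
move=> g0 L0 e0; set q := (X in X < 1) => q1.
have q0 : 0 < q.
  by rewrite ltr_pwDl ?divr_gt0 ?ltr0n // le_max lexx.
(* For [q < 1] this gives both [r > 1] and [r q < 1]. *)
pose r : R := 2 / (1 + q).
have r1 : 1 < r by rewrite /r ltr_pdivlMr; lra.
have rq : r * (g%:R / n.+1%:R) + r * Num.max 0 (- a) < 1.
  rewrite -mulrDr -/q /r mulrAC ltr_pdivrMr; lra.
have r0 : 0 < r by lra.
have [M M0 hM] := integral_weight_powR g0 r0 L0 rq.
(* Solves [T^(1-r) (M + 1) = e / 2], so the part above height [T] costs at most [e / 2]; [M + 1]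
   avoids dividing by zero. *)
pose T : R := (2 * (M + 1) / e) `^ (r - 1)^-1.
have B0 : 0 < 2 * (M + 1) / e by rewrite divr_gt0 //; lra.
have T0 : 0 < T by exact: powR_gt0.
have TM : T `^ (1 - r) * M <= e / 2.
  have r10 : r - 1 != 0 by rewrite gt_eqF // subr_gt0.
  rewrite /T -powRrM -(opprB r 1) mulrN mulVf //.
  rewrite powR_inv1 ?(ltW B0) // invf_div mulrAC ler_pdivrMr; last lra.
  have -> : e / 2 * (2 * (M + 1)) = e * M + e by field.
  by rewrite lerDl ltW.
exists (e / (2 * T)); first by rewrite divr_gt0 // mulr_gt0.
move=> x A xL mA AHL muA.
have mW : measurable_fun A (weight a x) by apply: measurable_funTS;
  exact: measurable_weight.
have mWr : measurable_fun A (fun y => (weight a x y `^ r)%:E).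
  by apply/measurable_EFinP; exact: measurable_powR_comp.
apply: (@le_trans _ _ (\int[mu]_(y in A) (T%:E + (T `^ (1 - r))%:E * (weight a x y `^
  r)%:E))%E).
  apply: ge0_le_integral => //.
  - by move=> y _; rewrite lee_fin weight_ge0.
  - exact/measurable_EFinP.
  - by apply: emeasurable_funD => //; exact: emeasurable_funM.
  move=> y _; rewrite -EFinM -EFinD lee_fin.
  have [wT|Tw] := leP (weight a x y) T.
    by rewrite ler_wpDr // mulr_ge0 ?powR_ge0.
  have w0 := lt_trans T0 Tw.
  rewrite ler_wpDl ?(ltW T0) //.
  have {1}-> : weight a x y = weight a x y `^ (1 - r) * weight a x y `^ r.
    by rewrite -powRD ?(gt_eqF w0) ?implybT // subrK powRr1 // ltW.
  rewrite ler_wpM2r ?powR_ge0 // -(opprB r 1) !powRN lef_pV2 ?posrE ?powR_gt0 //.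
  by rewrite ge0_ler_powR ?nnegrE ?ltW // subr_gt0.
rewrite ge0_integralD //; last 3 first.
- by move=> y _; rewrite lee_fin ltW.
- by move=> y _; rewrite -EFinM lee_fin mulr_ge0 ?powR_ge0.
- exact: emeasurable_funM.
rewrite integral_cst // ge0_integralZl_EFin ?powR_ge0 //; last first.
  by move=> y _; rewrite lee_fin powR_ge0.
have I1 : (\int[mu]_(y in A) (weight a x y `^ r)%:E <= M%:E)%E.
  apply: le_trans (hM x xL); apply: ge0_subset_integral => //.
  - exact: measurable_half_ball.
  - apply/measurable_EFinP; apply: measurable_powR_comp.
    by apply: measurable_funTS; exact: measurable_weight.
  - by move=> y _; rewrite lee_fin powR_ge0.
apply: (@le_trans _ _ ((T * (e / (2 * T)))%:E + (T `^ (1 - r) * M)%:E)%E).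
  apply: leeD.
    by rewrite EFinM lee_wpmul2l ?lee_fin ?ltW.
  by rewrite EFinM lee_wpmul2l ?lee_fin ?powR_ge0.
rewrite -EFinD lee_fin (_ : T * _ = e / 2); last by field; lra.
by lra.
Qed.

End uniform_smallness.

(** * The integral equation under the Kelvin transform *)

Section integral_aux.
Context d (T : measurableType d) {R : realType} (mu : {measure set T -> \bar R}).

Lemma ge0_integral_gt0 (D A : set T) (f : T -> R) : measurable D -> measurable A ->
  A `<=` D -> measurable_fun D f -> (forall x, D x -> 0 <= f x) ->
  (forall x, A x -> 0 < f x) -> (0 < mu A)%E -> (0 < \int[mu]_(x in D) (f x)%:E)%E.
Proof.
move=> mD mA AD mf f0 fA muA.
have I0 : (0 <= \int[mu]_(x in D) (f x)%:E)%E by apply: integral_ge0 => x Dx;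
  rewrite lee_fin f0.
rewrite lt_neqAle I0 andbT; apply/negP => /eqP I0E.
have mEf : measurable_fun D (EFin \o f) by exact/measurable_EFinP.
have : ae_eq mu D (EFin \o f) (cst 0%E).
  apply/ae_eq_integral_abs => //; rewrite I0E; apply: eq_integral => x;
    rewrite inE => Dx /=.
  by rewrite ger0_norm // f0.
move=> [N [mN N0 hN]]; move: muA; rewrite lt_neqAle => /andP[/eqP + _]; apply.
apply/esym; apply: (subset_measure0 mA mN) => // x Ax; apply: hN => /= h.
by have := fA _ Ax; have /= [->] := h (AD _ Ax); rewrite ltxx.
Qed.

Lemma measure_setD_null (A N : set T) : measurable A -> measurable N ->
  mu N = 0%E -> mu (A `\` N) = mu A.
Proof.
move=> mA mN N0; apply/eqP; rewrite eq_le; apply/andP; split.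
  by apply: le_measure; rewrite ?inE //; exact: measurableD.
apply: (@le_trans _ _ (mu ((A `\` N) `|` N))).
  apply: le_measure; rewrite ?inE //; first by apply: measurableU => //;
    exact: measurableD.
  by move=> x Ax; have [Nx|Nx] := pselect (N x); [right|left].
apply: (le_trans (measureU2 mu (measurableD mA mN) mN)).
by rewrite [X in (_ + X)%E]N0 adde0.
Qed.

End integral_aux.

Section rV_topology.
Context {R : realType} (n : nat).
Local Notation mu := (lebesgue_measure_rV n.+1).

Lemma nbhs_measure_gt0 (x : 'rV[R]_n.+1) (A : set 'rV[R]_n.+1) : measurable A ->
  nbhs x A -> (0 < mu A)%E.
Proof.
move=> mA /nbhs_ballP[e /= e0 eA].
pose K (i : 'I_n.+1) : set R := `](x ord0 i - e), (x ord0 i + e)[%classic.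
have mK i : measurable (K i) by exact: measurable_itv.
apply: (@lt_le_trans _ _ (mu [set y : 'rV[R]_n.+1 | forall i, K i (y ord0 i)])).
  rewrite lebesgue_measure_rV_box //.
  under eq_bigr => i _.
    rewrite /K lebesgue_measure_itv /= lte_fin ifT; last lra.
    rewrite -EFinB; over.
  by rewrite prodEFin lte_fin; apply: prodr_gt0 => i _; lra.
apply: le_measure; rewrite ?inE //; first exact: measurable_rV_box.
move=> y /= yK; apply: eA; split => // i j; rewrite (ord1 i : i = ord0).
have := yK j; rewrite /K /= in_itv /= => /andP[h1 h2].
by rewrite /ball /= ltr_norml; apply/andP; split; lra.
Qed.

Lemma closed_coord_bounded_compact (A : set 'rV[R]_n.+1) (L : R) : closed A ->
  (forall y i, A y -> `|y ord0 i| <= L) -> compact A.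
Proof.
move=> cA AL.
have cB : compact [set y : 'rV[R]_n.+1 | forall i, `[(- L), L]%classic (y ord0 i)].
  by apply: (@rV_compact _ _ (fun=> `[(- L), L]%classic)) => _; exact: segment_compact.
by apply: (subclosed_compact cA cB) => y Ay i /=; rewrite in_itv /= -ler_norml; exact: AL.
Qed.

Lemma compact_near (I : Type) (F : set_system I) (K : set 'rV[R]_n.+1)
    (P : I -> 'rV[R]_n.+1 -> Prop) : Filter F -> compact K ->
  (forall x, K x -> \forall x' \near x & i \near F, P i x') ->
  \forall i \near F, forall x, K x -> P i x.
Proof.
by move=> FF /compact_near_coveringP cK h; have := cK I F P FF h.
Qed.

End rV_topology.

Section inversion_split.
Context {R : realType} (n : nat).
Local Notation mu := (lebesgue_measure_rV n.+1).
Local Notation eball := (@eball R n.+1).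

(** Up to the null sphere, the outside of the ball is the image of the punctured ball. [f 0 = 0]
    takes care of the origin, which [inversion] fixes instead of sending to infinity. *)
Lemma integral_inversion_split (l : R) (f : 'rV[R]_n.+1 -> R) : 0 < l ->
  measurable_fun setT f -> (forall y, 0 <= f y) -> f 0 = 0 ->
  (\int[mu]_y (f y)%:E = \int[mu]_(y in eball l)
     (f y + f (inversion l y) * (l / enorm y) ^+ (2 * n.+1))%:E)%E.
Proof.
move=> l0 mf f0 f00; have mB := @measurable_eball R n.+1 l.
have mEf : measurable_fun setT (EFin \o f) by exact/measurable_EFinP.
pose S := [set y : 'rV[R]_n.+1 | enorm y = l].
have mS : measurable S.
  rewrite -[S]setTI; exact: (measurable_enorm measurableT (measurable_set1 l)).
pose O := ~` eball l `\` S.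
have mO : measurable O by apply: measurableD => //; exact: measurableC.
have mfi : measurable_fun setT (fun y => f (inversion l y) * (l / enorm y) ^+ (2 * n.+1)).
  apply: measurable_funM; first exact: (measurableT_comp mf (measurable_inversion l)).
  apply: measurable_funX; apply: measurable_funM => //.
  exact: (@measurable_enormVX R n.+1 1).
have fi0 y : 0 <= f (inversion l y) * (l / enorm y) ^+ (2 * n.+1).
  by rewrite mulr_ge0 // exprn_ge0 // divr_ge0 ?enorm_ge0 // ltW.
have -> : (\int[mu]_y (f y)%:E = \int[mu]_(y in eball l) (f y)%:E + \int[mu]_(y in ~`
  eball l) (f y)%:E)%E.
  rewrite -ge0_integral_setU ?setUv //; first exact: measurableC.
    by move=> y _; rewrite lee_fin.
  exact/disj_setPCl.
rewrite [RHS](eq_integral (fun y => (f y)%:E +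
    (f (inversion l y) * (l / enorm y) ^+ (2 * n.+1))%:E)%E) //.
rewrite [RHS]ge0_integralD //; [|by move=> y _; rewrite lee_fin|exact: measurable_funTS
  |by move=> y _; rewrite lee_fin|by apply/measurable_EFinP; exact: measurable_funTS].
congr (_ + _)%E.
have mBC : measurable (~` eball l) by exact: measurableC.
have mfC : measurable_fun (~` eball l) (fun y => (f y)%:E) by exact: measurable_funTS.
have f0C y : (~` eball l) y -> (0 <= (f y)%:E)%E by rewrite lee_fin.
rewrite (ge0_negligible_integral mS mBC mfC f0C (@sphere_null R n.+1 l l0)).
rewrite -/O integral_mkcond [RHS]integral_mkcond.
rewrite -(ge0_integral_inversion l0) //; first last.
- by rewrite patchE; case: ifP => // _; rewrite /= f00.
- by move=> y; rewrite patchE; case: ifP => // _; rewrite lee_fin.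
- by apply/(measurable_restrictT _ mO); exact: measurable_funTS.
apply: eq_integral => y _; have [->|y0] := eqVneq y 0.
  by rewrite inversion0 !patchE /= f00; do 2 case: ifP;
    rewrite ?mul0e ?inversion0 ?f00 ?mul0r.
have yn0 : 0 < enorm y by rewrite enorm_gt0.
rewrite !patchE; have -> : (inversion l y \in O) = (y \in eball l).
  apply/idP/idP; rewrite !inE /O /S /(eball _) /= enorm_inversion.
    move=> [/negP + /eqP h2]; rewrite -leNgt le_eqVlt eq_sym (negbTE h2) /=.
    by rewrite ltr_pdivlMr // expr2 ltr_pM2l.
  move=> yl; have ly : l < l ^+ 2 / enorm y by rewrite ltr_pdivlMr // expr2 ltr_pM2l.
  by split; [apply/negP; rewrite -leNgt ltW|move=> h; move: ly; rewrite h ltxx].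
by case: ifP => _; rewrite ?mul0e // EFinM.
Qed.

End inversion_split.

Section kelvin_transform.
Context {R : realType} (n g m : nat) (C a p : R) (u : 'rV[R]_n.+1 -> R).
Implicit Types (x y : 'rV[R]_n.+1) (l : R).
Local Notation mu := (lebesgue_measure_rV n.+1).
Local Notation H := (@halfspace R n.+1).
Local Notation eball := (@eball R n.+1).
Local Notation tau := (n.+1%:R + 2 * m%:R + 2 * a - p * g%:R).

Definition source y : R := last_coord y `^ a * u y `^ p.

(* Unlike [gkernel], nonnegative also at the diagonal, where [0^-1 = 0]. *)
Definition pkernel x y : R := Num.max 0 (gkernel g x y).

Definition pkernel_kelvin l x y : R := (l / enorm x) ^+ g * pkernel (inversion l x) y.

Definition kelvin l x : R := (l / enorm x) ^+ g * u (inversion l x).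

(** With [N = n.+1], the Jacobian contributes the exponent [2 N]; transforming the kernel uses up
    [g = N - 2 m] of it and leaves [N + 2 m]. *)
Definition source_kelvin l y : R :=
  (l / enorm y) ^+ (n.+1 + 2 * m) * source (inversion l y).

Lemma pkernel_ge0 x y : 0 <= pkernel x y.
Proof. by rewrite le_max lexx. Qed.

Lemma pkernelE x y : (0 < g)%N -> H x -> H y -> x != y -> pkernel x y = gkernel g x y.
Proof. by move=> g0 Hx Hy xy; apply/max_idPr; rewrite ltW // gkernel_gt0. Qed.

Lemma ratio_ge0 l y : 0 <= l -> 0 <= l / enorm y.
Proof. by move=> l0; rewrite divr_ge0 // enorm_ge0. Qed.

Lemma pkernel_kelvinE l x y : 0 < l ->
  pkernel_kelvin l x y = Num.max 0 (kelvin_kernel g l x y).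
Proof.
move=> l0; rewrite /pkernel_kelvin /pkernel maxr_pMr ?mulr0 //.
by rewrite exprn_ge0 // ratio_ge0 // ltW.
Qed.

Lemma pkernel_kelvin_ge0 l x y : 0 < l -> 0 <= pkernel_kelvin l x y.
Proof. by move=> l0; rewrite pkernel_kelvinE // le_max lexx. Qed.

Lemma pkernel_kelvin_sym l x y : 0 < l -> x != 0 -> y != 0 ->
  pkernel_kelvin l x y = (l / enorm y) ^+ g * pkernel x (inversion l y).
Proof.
move=> l0 x0 y0; rewrite pkernel_kelvinE // kelvin_kernelE ?gt_eqF //.
by rewrite /pkernel maxr_pMr ?mulr0 // exprn_ge0 // ratio_ge0 // ltW.
Qed.

Lemma measurable_pkernel x : measurable_fun setT (pkernel x).
Proof. by apply: measurable_maxr => //; exact: measurable_gkernel. Qed.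

Lemma measurable_pkernel_kelvin l x : measurable_fun setT (pkernel_kelvin l x).
Proof. by apply: measurable_funM => //; exact: measurable_pkernel. Qed.

Lemma measurable_ratioX l k : measurable_fun setT (fun y : 'rV[R]_n.+1 => (l / enorm y)
  ^+ k).
Proof.
apply: measurable_funX; apply: measurable_funM => //.
exact: (@measurable_enormVX R n.+1 1).
Qed.

Context (dim : n.+1 = (g + 2 * m)%N) (g0 : (0 < g)%N) (C0 : 0 < C) (p1 : 1 <= p).
Context (mu_u : measurable_fun setT u) (u0 : forall x, 0 <= u x)
  (uH : forall x, ~ H x -> u x = 0).

Lemma source_ge0 y : 0 <= source y.
Proof. by rewrite mulr_ge0 ?powR_ge0. Qed.

Lemma source_out y : ~ H y -> source y = 0.
Proof.
move=> /uH uy; rewrite /source uy powR0 ?mulr0 //.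
by rewrite gt_eqF // (lt_le_trans ltr01).
Qed.

Lemma source0 : source 0 = 0.
Proof. by apply: source_out; rewrite halfspaceE mxE ltxx. Qed.

Lemma measurable_source : measurable_fun setT source.
Proof.
apply: measurable_funM; apply: measurable_powR_comp => //.
exact: measurable_last_coord.
Qed.

Lemma measurable_kelvin l : measurable_fun setT (kelvin l).
Proof.
apply: measurable_funM; first exact: measurable_ratioX.
exact: (measurableT_comp mu_u (measurable_inversion l)).
Qed.

Lemma measurable_source_kelvin l : measurable_fun setT (source_kelvin l).
Proof.
apply: measurable_funM; first exact: measurable_ratioX.
exact: (measurableT_comp measurable_source (measurable_inversion l)).
Qed.

Lemma source_kelvin_ge0 l y : 0 <= l -> 0 <= source_kelvin l y.
Proof. by move=> l0; rewrite mulr_ge0 ?source_ge0 // exprn_ge0 // ratio_ge0. Qed.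

Lemma source_kelvin_out l y : 0 < l -> ~ H y -> source_kelvin l y = 0.
Proof.
move=> l0 Hy; rewrite /source_kelvin source_out ?mulr0 //.
by rewrite halfspace_inversion // gt_eqF.
Qed.

Lemma kelvin_ge0 l x : 0 <= l -> 0 <= kelvin l x.
Proof. by move=> l0; rewrite mulr_ge0 // exprn_ge0 // ratio_ge0. Qed.

(** The weight at the inverted point adds [2 a] to the exponent, and rewriting [u^p] through
    [kelvin l y] removes [p g]; what is left is [tau]. *)
Lemma source_kelvinE l y : 0 < l -> H y ->
  source_kelvin l y = (l / enorm y) `^ tau * (last_coord y `^ a * kelvin l y `^ p).
Proof.
move=> l0 Hy; have y0 := halfspace_neq0 Hy.
have yn0 : 0 < enorm y by rewrite enorm_gt0.
set q := l / enorm y; have q0 : 0 < q by exact: divr_gt0.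
have qn0 : q != 0 by rewrite gt_eqF.
have ln0 : 0 <= last_coord y by rewrite ltW.
have lE : last_coord (inversion l y) = q ^+ 2 * last_coord y.
  by rewrite /last_coord mxE expr_div_n.
rewrite /source_kelvin /source lE /kelvin -/q; clearbody q.
rewrite -!powR_mulrn ?(ltW q0) // !powRM ?powR_ge0 // -!powRrM.
have E : q `^ (n.+1 + 2 * m)%:R * q `^ (2%:R * a) = q `^ tau * q `^ (g%:R * p).
  rewrite -!powRD ?qn0 ?implybT //; congr (_ `^ _).
  by rewrite natrD natrM; ring.
set A := last_coord y `^ a; set B := u _ `^ p.
transitivity (q `^ (n.+1 + 2 * m)%:R * q `^ (2%:R * a) * (A * B)); first by ring.
by rewrite E; ring.
Qed.

Context (equ : forall x, H x -> (u x)%:E =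
  (\int[mu]_(y in H) (C * gkernel g x y * last_coord y `^ a * u y `^ p)%:E)%E).

Lemma u_repr x : H x -> ((u x)%:E = C%:E * \int[mu]_y (pkernel x y * source y)%:E)%E.
Proof.
move=> Hx; rewrite (equ Hx).
have mf : measurable_fun setT (fun y => pkernel x y * source y).
  by apply: measurable_funM; [exact: measurable_pkernel|exact: measurable_source].
have mH := @measurable_halfspace R n.
have f0 y : 0 <= pkernel x y * source y by rewrite mulr_ge0 ?pkernel_ge0 ?source_ge0.
transitivity (\int[mu]_(y in H) (C * (pkernel x y * source y))%:E)%E.
  apply: ae_eq_integral => //.
  - apply: measurable_funTS; apply/measurable_EFinP.
    apply: measurable_funM; last exact: measurable_powR_comp.
    apply: measurable_funM; last by apply: measurable_powR_comp;
      exact: measurable_last_coord.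
    by apply: measurable_funM => //; exact: measurable_gkernel.
  - by apply: measurable_funTS; apply/measurable_EFinP; exact: measurable_funM.
  exists [set x]; split; [exact: measurable_rV_set1|exact: lebesgue_measure_rV_set1|].
  move=> y /= /not_implyP[Hy]; apply: contra_notP => xy.
  rewrite pkernelE //; last by apply/eqP => e; apply: xy.
  by rewrite /source !mulrA.
under eq_integral do rewrite EFinM.
rewrite ge0_integralZl_EFin ?(ltW C0) //; last 2 first.
- by move=> y _; rewrite lee_fin.
- by apply: measurable_funTS; exact/measurable_EFinP.
congr (_ * _)%E; rewrite integral_mkcond; apply: eq_integral => y _.
by rewrite patchE; case: ifPn => //; rewrite notin_setE => /source_out ->; rewrite mulr0.
Qed.

Lemma kelvin_repr l x : 0 < l -> H x ->
  ((kelvin l x)%:E = C%:E * \int[mu]_y (pkernel_kelvin l x y * source y)%:E)%E.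
Proof.
move=> l0 Hx; have ln0 : l != 0 by rewrite gt_eqF.
have q0 : 0 <= (l / enorm x) ^+ g by rewrite exprn_ge0 // ratio_ge0 // ltW.
rewrite /kelvin EFinM u_repr ?halfspace_inversion // muleCA; congr (_ * _)%E.
rewrite -ge0_integralZl_EFin //.
- by apply: eq_integral => y _; rewrite /pkernel_kelvin -EFinM mulrA.
- by move=> y _; rewrite lee_fin mulr_ge0 ?pkernel_ge0 ?source_ge0.
- apply/measurable_EFinP; apply: measurable_funM; last exact: measurable_source.
  exact: measurable_pkernel.
Qed.

(** Two kernels meet two sources: [u] pairs them directly, [kelvin l u] crosswise. The difference of
    the integrands is therefore a product of a kernel difference and a source difference. *)
Lemma u_repr_ball l x : 0 < l -> H x -> ((u x)%:E = C%:E * \int[mu]_(y in eball l)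
  (pkernel x y * source y + pkernel_kelvin l x y * source_kelvin l y)%:E)%E.
Proof.
move=> l0 Hx; rewrite u_repr // (integral_inversion_split l0); last 3 first.
- by apply: measurable_funM; [exact: measurable_pkernel|exact: measurable_source].
- by move=> y; rewrite mulr_ge0 ?pkernel_ge0 ?source_ge0.
- by rewrite source0 mulr0.
congr (_ * _)%E; apply: eq_integral => y _; congr (_ + _)%:E.
rewrite /source_kelvin; have [->|y0] := eqVneq y 0.
  by rewrite inversion0 source0 !mulr0 mul0r.
rewrite pkernel_kelvin_sym ?(halfspace_neq0 Hx) // (_ : 2 * n.+1 = g + (n.+1 + 2 * m))%N.
  by rewrite exprD; ring.
by rewrite addnCA -dim mulnC muln2 addnn.
Qed.

Lemma kelvin_repr_ball l x : 0 < l -> H x -> ((kelvin l x)%:E = C%:E * \int[mu]_(y in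
  eball l)
  (pkernel_kelvin l x y * source y + pkernel x y * source_kelvin l y)%:E)%E.
Proof.
move=> l0 Hx; rewrite kelvin_repr // (integral_inversion_split l0); last 3 first.
- by apply: measurable_funM; [exact: measurable_pkernel_kelvin|exact: measurable_source].
- by move=> y; rewrite mulr_ge0 ?pkernel_kelvin_ge0 ?source_ge0.
- by rewrite source0 mulr0.
have ln0 : l != 0 by rewrite gt_eqF.
congr (_ * _)%E; apply: eq_integral => y _; congr (_ + _)%:E.
rewrite /source_kelvin; have [->|y0] := eqVneq y 0.
  by rewrite inversion0 source0 !mulr0 mul0r.
rewrite pkernel_kelvin_sym ?(halfspace_neq0 Hx) ?inversion_eq0 // inversionK //.
rewrite (_ : 2 * n.+1 = g + (n.+1 + 2 * m))%N; last first.
  by rewrite addnCA -dim mulnC muln2 addnn.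
rewrite exprD enorm_inversion (_ : l / (l ^+ 2 / enorm y) = (l / enorm y)^-1); last first.
  by field; rewrite ln0 enorm_eq0 y0.
have q0 : (l / enorm y) ^+ g != 0.
  by rewrite expf_neq0 // mulf_neq0 // invr_eq0 enorm_eq0.
by rewrite exprVn; field.
Qed.

End kelvin_transform.

(** * Moving spheres *)

Section comparison.
Context {R : realType} (n g m : nat) (C a p : R) (u : 'rV[R]_n.+1 -> R).
Implicit Types (x y : 'rV[R]_n.+1) (l : R).
Local Notation mu := (lebesgue_measure_rV n.+1).
Local Notation H := (@halfspace R n.+1).
Local Notation eball := (@eball R n.+1).
Local Notation tau := (n.+1%:R + 2 * m%:R + 2 * a - p * g%:R).
Local Notation kelvin := (@kelvin R n g u).
Local Notation source := (@source R n a p u).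
Local Notation source_kelvin := (@source_kelvin R n m a p u).
Local Notation pkernel := (@pkernel R n g).
Local Notation pkernel_kelvin := (@pkernel_kelvin R n g).

(** With [r = t / s] in [[0, 1]] and an integer [k >= p], one has [1 - r^p <= 1 - r^k <= k (1 - r)];
    this takes the place of the mean value theorem. *)
Lemma powR_sub_le : 1 <= p -> exists2 N : R, 0 <= N & forall U s t : R,
  0 <= t -> t <= s -> s <= U -> s `^ p - t `^ p <= N * U `^ (p - 1) * (s - t).
Proof.
move=> p1; pose k := (Num.truncn p).+1.
have pk : p <= k%:R by exact/ltW/truncnS_gt.
exists k%:R => // U s t t0 ts sU.
have [s0|s0] := leP s 0.
  have -> : s = 0 by apply/eqP; rewrite eq_le s0 (le_trans t0).
  have -> : t = 0 by apply/eqP; rewrite eq_le t0 (le_trans ts).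
  by rewrite !subrr mulr0.
pose r := t / s; have r0 : 0 <= r by rewrite divr_ge0 // ltW.
have r1 : r <= 1 by rewrite ler_pdivrMr // mul1r.
have tE : t = s * r by rewrite /r mulrCA divff ?mulr1 // gt_eqF.
have rk : 1 - r `^ p <= k%:R * (1 - r).
  apply: (@le_trans _ _ (1 - r ^+ k)).
    rewrite lerD2l lerN2 -powR_mulrn //.
    have [->|rn0] := eqVneq r 0.
      by rewrite !powR0 ?lexx // ?pnatr_eq0 // gt_eqF // (lt_le_trans ltr01).
    by apply: ger_powR => //; rewrite lt_neqAle eq_sym rn0 r0.
  rewrite -[1 - r ^+ k]opprB subrX1 -mulNr opprB mulrC ler_wpM2r ?subr_ge0 //.
  rewrite -[X in X%:R](card_ord k) -sumr_const; apply: ler_sum => i _.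
  exact: exprn_ile1.
have s_ge0 := ltW s0.
have -> : s `^ p - t `^ p = s `^ p * (1 - r `^ p) by rewrite tE powRM // mulrBr mulr1.
apply: (@le_trans _ _ (s `^ p * (k%:R * (1 - r)))); first by rewrite ler_wpM2l ?powR_ge0.
have -> : s `^ p * (k%:R * (1 - r)) = k%:R * s `^ (p - 1) * (s - t).
  rewrite -(mulr_powRB1 s_ge0 (lt_le_trans ltr01 p1)) tE; ring.
rewrite ler_wpM2r ?subr_ge0 // ler_wpM2l //.
by rewrite ge0_ler_powR ?nnegrE ?subr_ge0 // (le_trans s_ge0).
Qed.

Context (dim : n.+1 = (g + 2 * m)%N) (g0 : (0 < g)%N) (C0 : 0 < C) (p1 : 1 <= p).
Context (ag : g%:R / n.+1%:R + Num.max 0 (- a) < 1) (tau0 : 0 < tau).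
Context (mu_u : measurable_fun setT u) (u0 : forall x, 0 <= u x)
  (uH : forall x, ~ H x -> u x = 0)
  (bu : forall L, exists2 U, 0 <= U & forall x, enorm x < L -> u x <= U).
Context (equ : forall x, H x -> (u x)%:E =
  (\int[mu]_(y in H) (C * gkernel g x y * last_coord y `^ a * u y `^ p)%:E)%E).

Definition defect l : set 'rV[R]_n.+1 := [set y | [/\ H y, enorm y < l & kelvin l y < u
  y]].

Lemma measurable_defect l : measurable (defect l).
Proof.
have -> : defect l = (H `&` eball l) `&` [set y | kelvin l y < u y].
  by apply/seteqP; split=> y /=; [case=> ? ? ?|case=> -[]].
apply: measurableI; first exact: measurable_half_ball.
have := measurable_fun_ltr (measurable_kelvin g mu_u l) mu_u.
by move=> /(_ measurableT [set true]); rewrite setTI; exact.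
Qed.

(** Subcriticality: inside the ball [l / |y| > 1], so its power [tau > 0] is at least [1]. *)
Lemma source_kelvin_ge l y : H y -> 0 < l -> enorm y < l ->
  last_coord y `^ a * kelvin l y `^ p <= source_kelvin l y.
Proof.
move=> Hy l0 yl; have yn0 : 0 < enorm y by rewrite enorm_gt0 halfspace_neq0.
rewrite (source_kelvinE g m a p u0) //; apply: ler_peMl;
  first by rewrite mulr_ge0 ?powR_ge0.
have q1 : 1 <= l / enorm y by rewrite ler_pdivlMr // mul1r ltW.
by have := ler_powR q1 (ltW tau0); rewrite powRr0.
Qed.

Lemma pkernel_le x y : pkernel x y <= rkernel g (x - y).
Proof. by rewrite ge_max rkernel_ge0 gkernel_le. Qed.

Lemma pkernel_kelvin_lt l x y : 0 < l -> H x -> H y -> enorm x < l -> enorm y < l ->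
  x != y -> pkernel_kelvin l x y < pkernel x y.
Proof.
move=> l0 Hx Hy xl yl xy; rewrite pkernelE // pkernel_kelvinE //.
by rewrite gt_max gkernel_gt0 // kelvin_kernel_lt.
Qed.

Lemma ae_neq x : {ae mu, forall y, x != y}.
Proof.
exists [set x]; split; [exact: measurable_rV_set1|exact: lebesgue_measure_rV_set1|].
by move=> y /= /negP; rewrite negbK => /eqP ->.
Qed.

Lemma measurable_direct l x :
  measurable_fun setT (fun y => pkernel x y * source y + pkernel_kelvin l x y *
    source_kelvin l y).
Proof.
apply: measurable_funD; apply: measurable_funM.
- exact: measurable_pkernel.
- exact: measurable_source.
- exact: measurable_pkernel_kelvin.
- exact: measurable_source_kelvin.
Qed.

Lemma measurable_crossed l x :
  measurable_fun setT (fun y => pkernel_kelvin l x y * source y + pkernel x y *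
    source_kelvin l y).
Proof.
apply: measurable_funD; apply: measurable_funM.
- exact: measurable_pkernel_kelvin.
- exact: measurable_source.
- exact: measurable_pkernel.
- exact: measurable_source_kelvin.
Qed.

Lemma direct_ge0 l x y : 0 < l ->
  0 <= pkernel x y * source y + pkernel_kelvin l x y * source_kelvin l y.
Proof.
by move=> l0; rewrite addr_ge0 // mulr_ge0 ?pkernel_ge0 ?pkernel_kelvin_ge0 ?source_ge0
  ?source_kelvin_ge0 // ltW.
Qed.

Lemma crossed_ge0 l x y : 0 < l ->
  0 <= pkernel_kelvin l x y * source y + pkernel x y * source_kelvin l y.
Proof.
by move=> l0; rewrite addr_ge0 // mulr_ge0 ?pkernel_ge0 ?pkernel_kelvin_ge0 ?source_ge0
  ?source_kelvin_ge0 // ltW.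
Qed.

(** Off the defect set the product of differences is nonpositive; on it, it is at most a constant
    times [W] times the singular weight, whose integral there is small. [W] is any upper bound, so
    the lemma can be iterated without an attained supremum. *)
Lemma defect_halving L : 0 < L -> exists2 d : R, 0 < d & forall l W,
  0 < l -> l <= L -> (mu (defect l) < d%:E)%E -> 0 <= W ->
  (forall x, H x -> enorm x < l -> u x - kelvin l x <= W) ->
  forall x, H x -> enorm x < l -> u x - kelvin l x <= W / 2.
Proof.
move=> L0; have [U U0 uU] := bu L; have [N N0 hN] := powR_sub_le p1.
pose K := N * U `^ (p - 1) + 1.
have K0 : 0 < K by rewrite ltr_wpDl // mulr_ge0 ?powR_ge0.
(* The smallness for which the correction term, [C * (K * W) * e], equals [W / 2]. *)
have e0 : 0 < (2 * C * K)^-1 by rewrite invr_gt0 !mulr_gt0.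
have [d d0 hd] := integral_weight_small g0 L0 e0 ag.
exists d => // l W l0 lL mud W0 hW x Hx xl.
have mdef := measurable_defect l.
pose corr y := K * W * (\1_(defect l) y * weight g a x y).
have mw : measurable_fun setT (fun y => \1_(defect l) y * weight g a x y).
  by apply: measurable_funM; [exact: measurable_indic|exact: measurable_weight].
have mcorr : measurable_fun setT corr by exact: measurable_funM.
have w0 y : 0 <= \1_(defect l) y * weight g a x y by rewrite mulr_ge0 ?weight_ge0.
have KW0 : 0 <= K * W by rewrite mulr_ge0 // ltW.
have corr0 y : 0 <= corr y by exact: mulr_ge0.
have pointwise y : enorm y < l -> x != y ->
    pkernel x y * source y + pkernel_kelvin l x y * source_kelvin l y <=
    pkernel_kelvin l x y * source y + pkernel x y * source_kelvin l y + corr y.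
  move=> yl xy; have [Hy|Hy] := pselect (H y); last first.
    rewrite (source_out a p1 uH Hy) (source_kelvin_out m a p1 uH l0 Hy) !mulr0 !add0r.
    exact: corr0.
  have Klt := pkernel_kelvin_lt l0 Hx Hy xl yl xy.
  have sk := source_kelvin_ge Hy l0 yl.
  have ku0 : 0 <= kelvin l y by exact/kelvin_ge0/ltW.
  have la0 : 0 <= last_coord y `^ a by exact: powR_ge0.
  (* The direct integrand minus the crossed one factors as this product. *)
  suff : (pkernel x y - pkernel_kelvin l x y) * (source y - source_kelvin l y) <= corr y
    by lra.
  have kk : 0 <= pkernel x y - pkernel_kelvin l x y by rewrite subr_ge0 ltW.
  have [uk|ku] := leP (u y) (kelvin l y).
    apply: le_trans (corr0 y); rewrite mulr_ge0_le0 // subr_le0.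
    apply: le_trans sk; rewrite ler_wpM2l //.
    by rewrite ge0_ler_powR ?nnegrE // (le_trans ler01).
  have Dy : defect l y by [].
  rewrite /corr indicE mem_set // mul1r.
  have h1 : source y - source_kelvin l y <= last_coord y `^ a * (K * W).
    apply: (@le_trans _ _ (last_coord y `^ a * (u y `^ p - kelvin l y `^ p))).
      by rewrite mulrBr lerD2l lerN2.
    rewrite ler_wpM2l //; apply: (le_trans (hN U _ _ ku0 (ltW ku) (uU _ (lt_le_trans yl
      lL)))).
    rewrite ler_pM ?subr_ge0 ?(ltW ku) ?mulr_ge0 ?powR_ge0 //; last exact: hW.
    by rewrite /K lerDl.
  apply: (le_trans (ler_wpM2l kk h1)).
  rewrite /weight; have -> : K * W * (rkernel g (x - y) * last_coord y `^ a) =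
    rkernel g (x - y) * (last_coord y `^ a * (K * W)) by ring.
  rewrite ler_wpM2r //; first exact: mulr_ge0.
  apply: le_trans (pkernel_le x y); rewrite lerBlDr lerDl.
  exact: pkernel_kelvin_ge0.
have Iw : (\int[mu]_(y in eball l) (corr y)%:E <= (K * W * (2 * C * K)^-1)%:E)%E.
  rewrite (eq_integral (fun y => (K * W)%:E * (\1_(defect l) y * weight g a x y)%:E))%E;
    last first.
    by move=> y _; rewrite -EFinM.
  rewrite ge0_integralZl_EFin; last 4 first.
  - exact: measurable_eball.
  - by move=> y _; rewrite lee_fin.
  - by apply: measurable_funTS; exact/measurable_EFinP.
  - exact: KW0.
  rewrite [leRHS]EFinM lee_wpmul2l ?lee_fin //.
  have mW : measurable_fun setT (fun y => (weight g a x y)%:E).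
    by apply/measurable_EFinP; exact: measurable_weight.
  apply: le_trans (hd x (defect l) (lt_le_trans xl lL) mdef _ mud); last first.
    by move=> y [Hy yl _]; split => //; exact: lt_le_trans lL.
  rewrite integral_mkcond [leRHS]integral_mkcond; apply: ge0_le_integral => //.
  - by move=> y _; rewrite patchE; case: ifP => // _; rewrite lee_fin.
  - apply/(measurable_restrictT _ (@measurable_eball R n.+1 l)).
    by apply: measurable_funTS; exact/measurable_EFinP.
  - by apply/(measurable_restrictT _ mdef); exact: measurable_funTS.
  move=> y _; rewrite !patchE indicE; case: ifP => yl; case: ifP => yd;
    by rewrite ?mul1r ?mul0r ?lexx ?lee_fin ?weight_ge0.
(* Stated as a sum, so that only nonnegative integrals in the extended reals are compared. *)
have key : ((u x)%:E <= (kelvin l x)%:E + (W / 2)%:E)%E.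
  rewrite (u_repr_ball dim g0 C0 p1 mu_u uH equ l0 Hx).
  rewrite (kelvin_repr_ball dim g0 C0 p1 mu_u uH equ l0 Hx).
  have -> : W / 2 = C * (K * W * (2 * C * K)^-1) by field; rewrite !gt_eqF.
  rewrite [X in (_ <= _ + X)%E]EFinM -ge0_muleDr //; last 2 first.
  - by apply: integral_ge0 => y _; rewrite lee_fin crossed_ge0.
  - by rewrite lee_fin mulr_ge0 ?invr_ge0 ?mulr_ge0 // ltW.
  apply: lee_wpmul2l; first by rewrite lee_fin ltW.
  apply: le_trans (leeD2l _ Iw).
  have mB := @measurable_eball R n.+1 l.
  rewrite -ge0_integralD //; last 4 first.
  - by move=> y _; rewrite lee_fin crossed_ge0.
  - by apply: measurable_funTS; apply/measurable_EFinP; exact: measurable_crossed.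
  - by move=> y _; rewrite lee_fin.
  - by apply: measurable_funTS; exact/measurable_EFinP.
  apply: ae_ge0_le_integral => //.
  - by move=> y _; rewrite lee_fin direct_ge0.
  - by apply: measurable_funTS; apply/measurable_EFinP; exact: measurable_direct.
  - by move=> y _; rewrite -EFinD lee_fin addr_ge0 // crossed_ge0.
  - apply: measurable_funTS; apply: emeasurable_funD; last exact/measurable_EFinP.
    by apply/measurable_EFinP; exact: measurable_crossed.
  - apply: filterS (ae_neq x) => y xy yl; rewrite -EFinD lee_fin; exact: pointwise.
by rewrite lerBlDl; move: key; rewrite -EFinD lee_fin.
Qed.

(** Starting from a bound [U] of [u] on the ball, repeated halving gives [u - kelvin <= U / 2^k] for
    every [k]. *)
Lemma kelvin_ge_of_small_defect L : 0 < L -> exists2 d : R, 0 < d & forall l,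
  0 < l -> l <= L -> (mu (defect l) < d%:E)%E ->
  forall x, H x -> enorm x < l -> u x <= kelvin l x.
Proof.
move=> L0; have [d d0 hd] := defect_halving L0; have [U U0 uU] := bu L.
exists d => // l l0 lL mud x Hx xl.
have h k : forall x, H x -> enorm x < l -> u x - kelvin l x <= U / 2 ^+ k.
  elim: k => [|k IHk] y Hy yl.
    rewrite expr0 divr1 lerBlDr; apply: (le_trans (uU y (lt_le_trans yl lL))).
    by rewrite lerDl kelvin_ge0 // ltW.
  have W0 : 0 <= U / 2 ^+ k by rewrite divr_ge0.
  by have := hd l _ l0 lL mud W0 IHk y Hy yl; rewrite -mulrA -invfM -exprSr.
rewrite -subr_le0 leNgt; apply/negP => D0.
set D := u x - kelvin l x in D0.
have [k hk] : exists k, U / D < 2 ^+ k.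
  exists (Num.truncn (U / D)).+1; apply: (lt_trans (truncnS_gt _)).
  by rewrite -natrX ltr_nat ltn_expl.
have := h k x Hx xl; rewrite -/D ler_pdivlMr ?exprn_gt0 // leNgt => /negP; apply.
by move: hk; rewrite ltr_pdivrMr // mulrC.
Qed.

(** Strictness comes from [tau > 0]: even where [u] equals [kelvin l u], the factor
    [(l / |y|)^tau > 1] makes the transformed source larger, and the kernel difference is
    positive. *)
Lemma kelvin_gt l : (forall x, H x -> 0 < u x) -> 0 < l ->
  (forall x, H x -> enorm x < l -> u x <= kelvin l x) ->
  forall x, H x -> enorm x < l -> u x < kelvin l x.
Proof.
move=> u_gt0 l0 hl x Hx xl.
have mB := @measurable_eball R n.+1 l.
have mHB := @measurable_half_ball R n l.
(* The crossed integrand minus the direct one, cut off so as to be nonnegative also on the diagonal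
   and off the half-ball. *)
pose d y := \1_(H `&` eball l) y *
  Num.max 0 ((pkernel x y - pkernel_kelvin l x y) * (source_kelvin l y - source y)).
have d0 y : 0 <= d y by rewrite mulr_ge0 // le_max lexx.
have md : measurable_fun setT d.
  apply: measurable_funM; first exact: measurable_indic.
  apply: measurable_maxr => //; apply: measurable_funM; apply: measurable_funB.
  - exact: measurable_pkernel.
  - exact: measurable_pkernel_kelvin.
  - exact: measurable_source_kelvin.
  - exact: measurable_source.
have gt y : H y -> enorm y < l -> x != y ->
    0 < (pkernel x y - pkernel_kelvin l x y) * (source_kelvin l y - source y).
  move=> Hy yl xy; rewrite mulr_gt0 // subr_gt0; first exact: pkernel_kelvin_lt.
  have yn0 : 0 < enorm y by rewrite enorm_gt0 halfspace_neq0.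
  rewrite (source_kelvinE g m a p u0) // /(source _).
  apply: (@le_lt_trans _ _ (last_coord y `^ a * kelvin l y `^ p)).
    have ku0 : 0 <= kelvin l y by exact/kelvin_ge0/ltW.
    rewrite ler_wpM2l ?powR_ge0 //; apply: ge0_ler_powR; rewrite ?nnegrE //.
      exact: le_trans ler01 p1.
    exact: hl.
  have kp : 0 < last_coord y `^ a * kelvin l y `^ p.
    rewrite mulr_gt0 ?powR_gt0 //; exact: (lt_le_trans (u_gt0 y Hy) (hl y Hy yl)).
  rewrite ltr_pMl // /powR ifF ?gt_eqF ?divr_gt0 // expR_gt1 mulr_gt0 //.
  by rewrite ln_gt0 // ltr_pdivlMr // mul1r.
have Id : (0 < \int[mu]_(y in eball l) (d y)%:E)%E.
  apply: (@ge0_integral_gt0 _ _ _ _ _ ((H `&` eball l) `\` [set x])) => //.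
  - by apply: measurableD => //; exact: measurable_rV_set1.
  - by move=> y [[]].
  - exact: measurable_funTS.
  - move=> y [[Hy yl] /eqP xy]; rewrite /d indicE mem_set // mul1r lt_max.
    by rewrite gt ?orbT // eq_sym.
  - rewrite measure_setD_null //; [|exact: measurable_rV_set1|exact:
    lebesgue_measure_rV_set1].
    apply: (nbhs_measure_gt0 (x := x)) => //; apply: filterI.
      by apply: open_nbhs_nbhs; split => //; exact: open_halfspace.
    by apply: open_nbhs_nbhs; split => //; exact: open_eball.
have Iu := u_repr_ball dim g0 C0 p1 mu_u uH equ l0 Hx.
have Ik := kelvin_repr_ball dim g0 C0 p1 mu_u uH equ l0 Hx.
set I := (\int[mu]_(y in _) _)%E in Iu; set J := (\int[mu]_(y in _) _)%E in Ik.
have I0 : (0 <= I)%E by apply: integral_ge0 => y _; rewrite lee_fin direct_ge0.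
(* Finite because [u x] is; otherwise adding a positive integral would not give a strict
   inequality. *)
have Ifin : I \is a fin_num.
  rewrite ge0_fin_numE // ltey; apply/eqP => Ioo.
  by move: Iu; rewrite Ioo gt0_muley ?lte_fin.
have IJ : (I < J)%E.
  apply: (@lt_le_trans _ _ (I + \int[mu]_(y in eball l) (d y)%:E)%E).
    by rewrite -[ltLHS]adde0 lteD2lE.
  rewrite -ge0_integralD //; last 4 first.
  - by move=> y _; rewrite lee_fin direct_ge0.
  - by apply: measurable_funTS; apply/measurable_EFinP; exact: measurable_direct.
  - by move=> y _; rewrite lee_fin.
  - by apply: measurable_funTS; exact/measurable_EFinP.
  apply: ae_ge0_le_integral => //.
  - by move=> y _; rewrite -EFinD lee_fin addr_ge0 // direct_ge0.
  - apply: measurable_funTS; apply: emeasurable_funD; last exact/measurable_EFinP.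
    by apply/measurable_EFinP; exact: measurable_direct.
  - by move=> y _; rewrite lee_fin crossed_ge0.
  - by apply: measurable_funTS; apply/measurable_EFinP; exact: measurable_crossed.
  - apply: filterS (ae_neq x) => y xy yl; rewrite -EFinD lee_fin /d indicE.
    have [Hy|Hy] := pselect (H y).
      rewrite mem_set // mul1r (max_idPr _) ?(ltW (gt y Hy yl xy)) //.
      lra.
    rewrite memNset ?mul0r ?addr0; last by case.
    by rewrite (source_out a p1 uH Hy) (source_kelvin_out m a p1 uH l0 Hy) !mulr0.
by rewrite -lte_fin Iu Ik lte_pmul2l.
Qed.

End comparison.

(** * Continuation in the radius of the sphere *)

Section continuation.
Context {R : realType} (n g m : nat) (C a p : R) (u : 'rV[R]_n.+1 -> R).
Implicit Types (x y : 'rV[R]_n.+1) (l : R).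
Local Notation mu := (lebesgue_measure_rV n.+1).
Local Notation H := (@halfspace R n.+1).
Local Notation eball := (@eball R n.+1).
Local Notation tau := (n.+1%:R + 2 * m%:R + 2 * a - p * g%:R).
Local Notation kelvin := (@kelvin R n g u).
Local Notation source := (@source R n a p u).
Local Notation pkernel := (@pkernel R n g).

Context (dim : n.+1 = (g + 2 * m)%N) (g0 : (0 < g)%N) (C0 : 0 < C) (p1 : 1 <= p).
Context (ag : g%:R / n.+1%:R + Num.max 0 (- a) < 1) (tau0 : 0 < tau).
Context (mu_u : measurable_fun setT u) (u0 : forall x, 0 <= u x)
  (uH : forall x, ~ H x -> u x = 0)
  (cu : forall x, H x -> {for x, continuous u})
  (bu : forall L, exists2 U, 0 <= U & forall x, enorm x < L -> u x <= U).
Context (equ : forall x, H x -> (u x)%:E =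
  (\int[mu]_(y in H) (C * gkernel g x y * last_coord y `^ a * u y `^ p)%:E)%E).

Lemma nbhs_halfspace x : H x -> nbhs x H.
Proof. by move=> Hx; apply: open_nbhs_nbhs; split => //; exact: open_halfspace. Qed.

(** A strong maximum principle: [u] is positive near [x0], and the kernel spreads that positivity to
    every point. *)
Lemma u_gt0_all x0 : H x0 -> 0 < u x0 -> forall x, H x -> 0 < u x.
Proof.
move=> Hx0 ux0 x Hx.
have mP : measurable (H `&` [set y | 0 < u y]).
  apply: measurableI; first exact: measurable_halfspace.
  have := measurable_fun_ltr (measurable_cst (0 : R)) mu_u.
  by move=> /(_ measurableT [set true]); rewrite setTI; exact.
rewrite -lte_fin (u_repr g0 C0 p1 mu_u uH equ Hx) mule_gt0 ?lte_fin //.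
apply: (@ge0_integral_gt0 _ _ _ _ _ ((H `&` [set y | 0 < u y]) `\` [set x])) => //.
- by apply: measurableD => //; exact: measurable_rV_set1.
- by apply: measurable_funM; [exact: measurable_pkernel|exact: measurable_source].
- by move=> y _; rewrite mulr_ge0 ?pkernel_ge0 ?source_ge0.
- move=> y [[Hy uy] xy]; rewrite pkernelE //; last by apply/eqP => e; exact: xy.
  rewrite mulr_gt0 //; last by rewrite mulr_gt0 ?powR_gt0.
  by apply: gkernel_gt0 => //; apply/eqP => e; exact: xy.
- rewrite measure_setD_null //; [|exact: measurable_rV_set1|exact:
  lebesgue_measure_rV_set1].
  apply: (nbhs_measure_gt0 (x := x0)) => //; apply: filterI; first exact: nbhs_halfspace.
  exact: (cu Hx0 (lt_nbhsr ux0)).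
Qed.

(** Continuity is joint in the point and the radius, so that a strict inequality on a compact set
    persists for all nearby radii at once. *)
Lemma kelvin_continuous x l : 0 < l -> H x ->
  {for (x, l), continuous (fun z : 'rV[R]_n.+1 * R => kelvin z.2 z.1)}.
Proof.
move=> l0 Hx; have x0 : enorm x != 0 by rewrite enorm_eq0 halfspace_neq0.
have c1 : (fun z : 'rV[R]_n.+1 * R => z.1) z @[z --> (x, l)] --> x by exact: cvg_fst.
have c2 : (fun z : 'rV[R]_n.+1 * R => z.2) z @[z --> (x, l)] --> l by exact: cvg_snd.
have ce : enorm z.1 @[z --> (x, l)] --> enorm x.
  exact: (continuous_cvg _ (@enorm_continuous R n.+1 x) c1).
have cX (f : 'rV[R]_n.+1 * R -> R) (b : R) k :
    f z @[z --> (x, l)] --> b -> (f z) ^+ k @[z --> (x, l)] --> b ^+ k.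
  by move=> cf; exact: (continuous_cvg _ (@exprn_continuous R k b) cf).
apply: cvgM.
  apply: cX; apply: cvgM => //; exact: cvgV.
have Hix : H (inversion l x) by rewrite halfspace_inversion // gt_eqF.
apply: (cvg_comp (fun z : 'rV[R]_n.+1 * R => inversion z.2 z.1) u _ (cu Hix)).
rewrite /inversion; apply: cvgZ => //; apply: cvgM; first exact: cX.
by apply: cvgV; [rewrite sqrf_eq0|exact: cX].
Qed.

Lemma kelvin_ge_closed l : 0 < l ->
  (forall k, 0 < k -> k < l -> forall x, H x -> enorm x < k -> u x <= kelvin k x) ->
  forall x, H x -> enorm x < l -> u x <= kelvin l x.
Proof.
move=> l0 hk x Hx xl; rewrite leNgt; apply/negP => ku.
have ck : kelvin k x @[k --> l] --> kelvin l x.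
  apply: (cvg_comp (fun k : R => (x, k)) (fun z => kelvin z.2 z.1) _ (kelvin_continuous
    l0 Hx)).
  exact: (cvg_pair (cvg_cst x) cvg_id).
have /nbhs_ballP[e /= e0 he] := ck _ (lt_nbhsl ku).
(* A radius below [l] that still exceeds [enorm x] and lies within [e / 2] of [l]. *)
pose k := Num.max ((l + enorm x) / 2) (l - e / 2).
have xk : enorm x < k by rewrite lt_max; apply/orP; left; lra.
have kl : k < l by rewrite gt_max; apply/andP; split; lra.
have k0 : 0 < k by exact: le_lt_trans (enorm_ge0 x) xk.
have : kelvin k x < u x.
  apply: he; rewrite /ball /= ger0_norm ?subr_ge0 ?(ltW kl) //.
  have : l - e / 2 <= k by rewrite le_max lexx orbT.
  lra.
by rewrite ltNge hk.
Qed.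

(** On a compact core the strict inequality persists for radii slightly above [l]. The defect set is
    then confined to the thin complement of the core, where smallness of its measure makes it
    empty. *)
Lemma kelvin_ge_open l : (forall x, H x -> 0 < u x) -> 0 < l ->
  (forall x, H x -> enorm x < l -> u x <= kelvin l x) ->
  exists2 h, 0 < h & forall k, l <= k -> k < l + h ->
    forall x, H x -> enorm x < k -> u x <= kelvin k x.
Proof.
move=> u_gt0 l0 hl.
have hlt := kelvin_gt dim g0 C0 p1 tau0 mu_u u0 uH equ u_gt0 l0 hl.
(* An upper bound for the radii to come: [e < l] keeps them below [2 * l]. *)
have l20 : 0 < 2 * l by rewrite mulr_gt0.
have [d d0 hd] := kelvin_ge_of_small_defect dim g0 C0 p1 ag tau0 mu_u u0 uH bu equ l20.
have [e /andP[e0 el] he] := @thin_complement R n l d l0 d0.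
pose Q := [set y : 'rV[R]_n.+1 | e <= last_coord y] `&` [set y | enorm y <= l - e].
have cQ : compact Q.
  apply: (@closed_coord_bounded_compact _ _ _ l).
    apply: closedI.
      exact: (closed_comp (f := @last_coord R n.+1) (fun x _ => @last_coord_continuous R
        n x) (@closed_ge _ e)).
    exact: (closed_comp (f := @enorm R n.+1) (fun x _ => @enorm_continuous R n.+1 x)
      (@closed_le _ (l - e))).
  by move=> y i [_ /= yl]; apply: (le_trans (coord_le_enorm _ _)); lra.
have QP x : Q x -> \forall x' \near x & k \near nbhs l, u x' < kelvin k x'.
  move=> [/= xe xl]; have Hx : H x by exact: lt_le_trans e0 xe.
  have xl' : enorm x < l by lra.
  have cd : (kelvin z.2 z.1 - u z.1) @[z --> (x, l)] --> kelvin l x - u x.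
    apply: cvgB; first exact: kelvin_continuous.
    by apply: (cvg_comp (fun z : 'rV[R]_n.+1 * R => z.1) u _ (cu Hx)); exact: cvg_fst.
  have gap : 0 < kelvin l x - u x by rewrite subr_gt0 hlt.
  apply: (@filterS _ (nbhs (x, l)) _ (fun z => 0 < kelvin z.2 z.1 - u z.1)).
    by move=> z /=; rewrite subr_gt0.
  exact: (cd _ (lt_nbhsr gap)).
have /nbhs_ballP[r /= r0 hr] := compact_near (nbhs_filter l) cQ QP.
exists (Num.min e r); first by rewrite lt_min e0.
move=> k lk kl; have ke : k < l + e by apply: (lt_le_trans kl);
  rewrite lerD2l ge_min lexx.
have kr : k < l + r by apply: (lt_le_trans kl); rewrite lerD2l ge_min lexx orbT.
have k0 : 0 < k by exact: lt_le_trans lk.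
apply: hd => //; first by lra.
apply: he; first exact: (measurable_defect g mu_u).
move=> y [Hy yk ky]; split => //; first exact: lt_trans ke.
move=> yQ; suff : u y < kelvin k y by move=> /(lt_trans ky); rewrite ltxx.
by apply: hr => //; rewrite /ball /= ltr_norml; apply/andP; split; lra.
Qed.

(** The infimum of the failing radii would be positive and itself a good radius, hence followed by
    an interval of good radii; but failing radii accumulate at it or include it. *)
Lemma kelvin_ge_all : (forall x, H x -> 0 < u x) -> forall l, 0 < l ->
  forall x, H x -> enorm x < l -> u x <= kelvin l x.
Proof.
move=> u_gt0 l1 l10.
pose P l := forall x, H x -> enorm x < l -> u x <= kelvin l x.
have [//|nPl1] := pselect (P l1).
pose S : set R := [set l | 0 < l /\ ~ P l].
have [d d0 hd] := kelvin_ge_of_small_defect dim g0 C0 p1 ag tau0 mu_u u0 uH bu equ ltr01.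
have [e e0 he] := @small_eball R n.+1 d isT d0.
have small l : 0 < l -> l <= Num.min e 1 -> P l.
  rewrite le_min => l0 /andP[le l1']; apply: hd => //.
  apply: (le_lt_trans _ he); apply: le_measure; rewrite ?inE.
  - exact: (measurable_defect g mu_u).
  - exact: measurable_eball.
  - by move=> y [_ yl _]; exact: lt_le_trans le.
have Slb : lbound S (Num.min e 1).
  move=> l [l0 nPl]; rewrite leNgt; apply/negP => le; apply: nPl; apply: small => //.
  exact: ltW.
have hS : has_inf S by split; [exists l1|exists (Num.min e 1)].
have s0 : 0 < inf S.
  apply: (@lt_le_trans _ _ (Num.min e 1)); first by rewrite lt_min e0 ltr01.
  by apply: lb_le_inf => //; exists l1.
have below k : 0 < k -> k < inf S -> P k.
  move=> k0; rewrite ltNge => /negP kS; apply: contrapT => nPk; apply: kS.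
  exact: (ge_inf hS.2 (conj k0 nPk)).
have Ps : P (inf S) := kelvin_ge_closed s0 below.
have [h h0 hh] := kelvin_ge_open u_gt0 s0 Ps.
have [k Sk ks] := inf_adherent h0 hS; have sk := ge_inf hS.2 Sk.
by case: Sk => k0 []; exact: hh.
Qed.

(** * Growth on a fixed compact set of positive measure *)

Definition window_side (i : 'I_n.+1) : set R :=
  if i == ord_max then `[1, 2]%classic else `[(-2), 2]%classic.

Definition window : set 'rV[R]_n.+1 := [set y | forall i, window_side i (y ord0 i)].

Lemma window_coord y i : window y -> `|y ord0 i| <= 2.
Proof.
move=> /(_ i); rewrite /window_side; case: ifP => _ /=; rewrite in_itv /= => /andP[h1 h2];
  by rewrite ler_norml; apply/andP; split; lra.
Qed.

Lemma window_last y : window y -> 1 <= last_coord y <= 2.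
Proof. by move=> /(_ ord_max); rewrite /window_side eqxx /= in_itv. Qed.

Lemma window_halfspace y : window y -> H y.
Proof. by move=> /window_last /andP[h _]; rewrite /halfspace /= (lt_le_trans ltr01). Qed.

Lemma compact_window : compact window.
Proof.
apply: rV_compact => i; rewrite /window_side.
by case: ifP => _; exact: segment_compact.
Qed.

Lemma measurable_window : measurable window.
Proof.
apply: measurable_rV_box => i; rewrite /window_side.
by case: ifP => _; exact: measurable_itv.
Qed.

Lemma window_measure : exists2 M : R, 0 < M & mu window = M%:E.
Proof.
exists (\prod_(i < n.+1) (if i == ord_max then 1 else 4)).
  by apply: prodr_gt0 => i _; case: ifP.
rewrite -prodEFin /window lebesgue_measure_rV_box => [|i]; last first.
  by rewrite /window_side; case: ifP => _; exact: measurable_itv.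
apply: eq_bigr => i _; rewrite /window_side; case: ifP => _;
  rewrite lebesgue_measure_itv /= lte_fin ifT ?ltr1n //.
- by rewrite -EFinB; congr EFin; ring.
- by rewrite -EFinB; congr EFin; ring.
- by lra.
Qed.

(** The kernel is the drop of [radial] over an increment [4 x_n y_n >= 4], and by convexity that
    drop is smallest at the largest squared distance. *)
Lemma gkernel_window : exists2 k : R, 0 < k & forall x y, window x -> window y -> x != y
  ->
  k <= gkernel g x y.
Proof.
(* Coordinates of two points of the window differ by at most [4]; the extra [1] makes the bound on
   the squared distance strict. *)
pose L : R := n.+1%:R * 16 + 1; have L0 : 0 < L by rewrite ltr_pwDr.
exists (radial g L - radial g (L + 4)).
  by rewrite subr_gt0 radial_lt // ltrDl.
move=> x y Qx Qy xy; rewrite gkernelE.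
set s := sqnorm (x - y); set e := 4 * _.
have s0 : 0 < s by rewrite sqnorm_gt0 subr_eq0.
have sL : s < L.
  rewrite /L ltr_pwDr // /s /sqnorm.
  apply: (@le_trans _ _ (\sum_(i < n.+1) 16)); last first.
    by rewrite sumr_const card_ord mulr_natl.
  apply: ler_sum => i _; rewrite !mxE.
  have := window_coord i Qx; have := window_coord i Qy.
  rewrite !ler_norml => /andP[h1 h2] /andP[h3 h4].
  have : `|x ord0 i - y ord0 i| <= 4 by rewrite ler_norml; apply/andP; split; lra.
  move=> h; rewrite -real_normK ?num_real // (_ : 16 = 4 ^+ 2); last by ring.
  by rewrite lerXn2r ?nnegrE.
have /andP[x1 _] := window_last Qx; have /andP[y1 _] := window_last Qy.
have e4 : 4 <= e by rewrite /e ler_peMr // -[1]mulr1 ler_pM.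
have e0 : 0 < e by exact: lt_le_trans e4.
have := @radial_convex R g s (L - s) e g0 s0; rewrite subr_gt0 (addrC s (L - s)) subrK =>
  /(_ sL e0).
move=> /ltW; apply: le_trans; rewrite lerD2l lerN2.
have [->//|ne] := eqVneq e 4; apply: ltW; apply: radial_lt => //;
  first by rewrite addr_gt0.
by rewrite ltrD2l lt_neqAle eq_sym ne.
Qed.

Lemma powR_window : exists2 k : R, 0 < k & forall t : R, 1 <= t <= 2 -> k <= t `^ a.
Proof.
exists (Num.min 1 (2 `^ a)); first by rewrite lt_min ltr01 powR_gt0.
move=> t /andP[t1 t2]; have t0 : 0 < t by exact: lt_le_trans t1.
rewrite ge_min; have [a0|/ltW a0] := leP 0 a.
  by rewrite -{1}(powRr0 t) ler_powR.
apply/orP; right; rewrite -[a]opprK !(powRN _ (- a)) lef_pV2 ?posrE ?powR_gt0 //.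
by rewrite ge0_ler_powR ?nnegrE ?oppr_ge0 // ltW.
Qed.

Definition dilate (t : R) x : R := t ^+ g * u (t ^+ 2 *: x).

(** The sphere of radius [t * enorm x] depends on [x]; its inversion maps [x] to [t ^+ 2 *: x]. *)
Lemma dilate_ge t x : (forall y, H y -> 0 < u y) -> 1 < t -> H x -> u x <= dilate t x.
Proof.
move=> u_gt0 t1 Hx; have xn0 : 0 < enorm x by rewrite enorm_gt0 halfspace_neq0.
have t0 := lt_trans ltr01 t1.
have tx0 : 0 < t * enorm x by rewrite mulr_gt0.
have := kelvin_ge_all u_gt0 tx0 Hx; rewrite ltr_pMl // => /(_ t1).
rewrite /(kelvin _ _) /inversion mulfK ?gt_eqF // (exprMn _ t) mulfK //.
by rewrite expf_neq0 // gt_eqF.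
Qed.

(** Restricting the rescaled equation to the window bounds [dilate t] below by an integral of its
    own power [p]. Since [p >= 1], one factor is bounded by [V] and the rest by [c^(p-1)], so the
    bound is linear in [V] with [b] independent of [t]. *)
Lemma dilate_growth (c : R) : 0 < c -> exists2 b : R, 0 < b & forall t V, 0 < t -> 0 <= V
  ->
  (forall y, window y -> c <= dilate t y) -> (forall y, window y -> V <= dilate t y) ->
  forall x, window x -> b * t `^ tau * V <= dilate t x.
Proof.
move=> c0; have [M M0 muQ] := window_measure.
have [k k0 hk] := gkernel_window; have [q q0 hq] := powR_window.
exists (C * k * q * c `^ (p - 1) * M); first by rewrite !mulr_gt0 ?powR_gt0.
move=> t V t0 V0 hc hV x Qx.
have Hx := window_halfspace Qx.
have t20 : 0 < t ^+ 2 by rewrite exprn_gt0.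
have Htx : H (t ^+ 2 *: x) by rewrite halfspaceZ.
pose B : R := ((t ^+ 2) ^+ g)^-1 * k * (t `^ (2 * a - p * g%:R) * q * (c `^ (p - 1) * V)).
have B0 : 0 <= B.
  by rewrite !mulr_ge0 ?powR_ge0 ?invr_ge0 ?exprn_ge0 // ?ltW // exprn_gt0.
have mF : measurable_fun setT (fun y => (pkernel (t ^+ 2 *: x) y * source y)%:E).
  by apply/measurable_EFinP; apply: measurable_funM;
    [exact: measurable_pkernel|exact: measurable_source].
have F0 y : (0 <= (pkernel (t ^+ 2 *: x) y * source y)%:E)%E.
  by rewrite lee_fin mulr_ge0 ?pkernel_ge0 ?source_ge0.
have mFt : measurable_fun setT (fun y => (pkernel (t ^+ 2 *: x) (t ^+ 2 *: y) * source (t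
  ^+ 2 *: y))%:E).
  exact: (measurableT_comp mF (measurable_scaler (f := cst (t ^+ 2)) (measurable_cst _))).
have pointwise y : x != y -> window y ->
    B <= pkernel (t ^+ 2 *: x) (t ^+ 2 *: y) * source (t ^+ 2 *: y).
  move=> xy Qy; have Hy := window_halfspace Qy.
  have Hty : H (t ^+ 2 *: y) by rewrite halfspaceZ.
  have txy : t ^+ 2 *: x != t ^+ 2 *: y.
    by apply: contraNneq xy => /(scalerI (lt0r_neq0 t20)) ->.
  rewrite pkernelE // gkernelZ // /B; apply: ler_pM.
  - by rewrite mulr_ge0 ?invr_ge0 ?exprn_ge0 // ltW // exprn_gt0.
  - by rewrite !mulr_ge0 ?powR_ge0 // ltW.
  - apply: ler_wpM2l (hk x y Qx Qy xy).
    by rewrite invr_ge0 exprn_ge0 // ltW.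
  have vE : u (t ^+ 2 *: y) = t `^ (- g%:R) * dilate t y.
    by rewrite /dilate powRN powR_mulrn ?(ltW t0) // mulKf // expf_neq0 // gt_eqF.
  have dy0 : 0 < dilate t y by exact: lt_le_trans (hc y Qy).
  rewrite /(source _) vE powRM ?powR_ge0 ?(ltW dy0) //.
  have -> : last_coord (t ^+ 2 *: y) = t ^+ 2 * last_coord y by rewrite /last_coord mxE.
  have /andP[y1 y2] := window_last Qy.
  have yl0 : 0 <= last_coord y by exact: le_trans y1.
  rewrite -powR_mulrn ?(ltW t0) // (powRM _ (powR_ge0 _ _) yl0) -!powRrM.
  have -> : t `^ (2 * a - p * g%:R) = t `^ (2%:R * a) * t `^ (- g%:R * p).
    by rewrite -powRD ?(gt_eqF t0) ?implybT //; congr (_ `^ _); ring.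
  have -> : t `^ (2%:R * a) * last_coord y `^ a * (t `^ (- g%:R * p) * dilate t y `^ p) =
    (t `^ (2%:R * a) * t `^ (- g%:R * p)) * last_coord y `^ a * dilate t y `^ p by ring.
  apply: ler_pM; rewrite ?mulr_ge0 ?powR_ge0 ?(ltW q0) //.
    by rewrite ler_wpM2l ?mulr_ge0 ?powR_ge0 // hq // y1.
  rewrite -(mulr_powRB1 (ltW dy0) (lt_le_trans ltr01 p1)) mulrC.
  apply: ler_pM; rewrite ?powR_ge0 //; first exact: hV.
  by rewrite ge0_ler_powR ?nnegrE ?subr_ge0 ?(ltW c0) ?(ltW dy0) // hc.
have mQ := measurable_window.
have I : (B%:E * mu window <= \int[mu]_y (pkernel (t ^+ 2 *: x) (t ^+ 2 *: y) * source (t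
  ^+ 2 *: y))%:E)%E.
  rewrite -integral_cst //.
  apply: (@le_trans _ _ (\int[mu]_(y in window) (pkernel (t ^+ 2 *: x) (t ^+ 2 *: y) *
    source (t ^+ 2 *: y))%:E)%E).
    apply: ae_ge0_le_integral => //.
    - exact: measurable_funTS.
    - by apply: filterS (ae_neq x) => y xy Qy; rewrite lee_fin pointwise.
  by apply: ge0_subset_integral => // y _; rewrite lee_fin mulr_ge0 ?pkernel_ge0
    ?source_ge0.
have ut : ((C * (t ^+ 2) ^+ n.+1 * (B * M))%:E <= (u (t ^+ 2 *: x))%:E)%E.
  rewrite (u_repr g0 C0 p1 mu_u uH equ Htx) -(ge0_integral_scaler t20 mF F0).
  rewrite muleA -EFinM [leLHS]EFinM; apply: lee_wpmul2l.
    by rewrite lee_fin mulr_ge0 ?exprn_ge0 ?(ltW C0) // ltW.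
  by rewrite EFinM -muQ.
move: ut; rewrite lee_fin => /(ler_wpM2l (exprn_ge0 g (ltW t0))); apply: le_trans.
rewrite le_eqVlt; apply/orP; left; apply/eqP.
(* The powers of [t]: [g] from [dilate], [2 N] from the Jacobian, [- 2 g] from the kernel,
   [2 a - p g] from weight and source; with [N = g + 2 m] they add up to [tau]. *)
have tE : t `^ tau = t ^+ g * (t ^+ 2) ^+ n.+1 * ((t ^+ 2) ^+ g)^-1 * t `^ (2 * a - p *
  g%:R).
  rewrite -!exprM -!powR_mulrn ?(ltW t0) // -powRN -!powRD ?(gt_eqF t0) ?implybT //.
  by congr (_ `^ _); rewrite dim !(natrM, natrD); ring.
by rewrite tE /B; ring.
Qed.

Lemma u_eq0_halfspace x : H x -> u x = 0.
Proof.
move=> Hx; apply/eqP/negPn/negP => ux.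
have ux0 : 0 < u x by rewrite lt_neqAle eq_sym ux u0.
have u_gt0 := u_gt0_all Hx ux0.
have [c c0 hc] : exists2 c : R, 0 < c & forall y, window y -> c < u y.
  have : \forall c \near 0^'+, forall y, window y -> c < u y.
    apply: (compact_near _ compact_window) => y /window_halfspace Hy.
    have uy := u_gt0 y Hy.
    exists ([set z | u y / 2 < u z], [set c | c < u y / 2]) => /=; last first.
      by move=> [z k] /= [h1 h2]; exact: lt_trans h1.
    have uy2 : u y / 2 < u y by lra.
    split; first exact: (cu Hy (lt_nbhsr uy2)).
    by apply: nbhs_right_lt; lra.
  move=> h; have [c [c0 hc]] : exists c : R, 0 < c /\ forall y, window y -> c < u y.
    near ((0:R)^'+) => c; exists c; split => //; near: c => //.
  by exists c.
have [b b0 hb] := dilate_growth c0.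
(* The second entry ensures [b * t ^ tau >= 2], the first that [t > 1]. *)
pose t := Num.max 2 ((2 / b) `^ (tau^-1)).
have t2 : 2 <= t by rewrite le_max lexx.
have t1 : 1 < t by lra.
have t0 : 0 < t by lra.
have bt : 2 <= b * t `^ tau.
  rewrite mulrC -ler_pdivrMr //; apply: (@le_trans _ _ (((2 / b) `^ tau^-1) `^ tau)).
    by rewrite -powRrM mulVf ?gt_eqF // powRr1 // divr_ge0 // ltW.
  rewrite ge0_ler_powR ?nnegrE ?powR_ge0 ?(ltW tau0) ?(ltW t0) //.
  by rewrite le_max lexx orbT.
have ht y : window y -> c <= dilate t y.
  move=> Qy; apply: (le_trans (ltW (hc y Qy))).
  by apply: dilate_ge => //; exact: window_halfspace.
(* [t] stays fixed: each use of the growth estimate doubles the lower bound for one and the same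
   function. *)
have grow k : forall y, window y -> 2 ^+ k * c <= dilate t y.
  elim: k => [|k IHk] y Qy; first by rewrite expr0 mul1r ht.
  have V0 : 0 <= 2 ^+ k * c by rewrite mulr_ge0 // ltW.
  apply: le_trans (hb t _ t0 V0 ht IHk y Qy).
  by rewrite exprS -mulrA ler_wpM2r.
pose y0 : 'rV[R]_n.+1 := \row_i 1.
have Qy0 : window y0.
  by move=> i; rewrite mxE /window_side; case: ifP => _; rewrite /= in_itv /=;
    apply/andP; split; lra.
pose k := (Num.truncn (dilate t y0 / c)).+1.
have := grow k y0 Qy0; rewrite leNgt => /negP; apply.
rewrite mulrC -ltr_pdivrMl // mulrC; apply: (lt_trans (truncnS_gt _)).
by rewrite -natrX ltr_nat ltn_expl.
Unshelve. all: by end_near. Qed.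

End continuation.

(** * Reduction to a function vanishing off the half-space, and passage to the closure *)

Theorem theorem1p14 (R : realType) (m n : nat) (C a p : R)
  (u : 'rV[R]_n -> R) :
  (1 <= m)%N -> (2 * m < n)%N ->
  0 < C ->
  is_fundamental_solution m (fun x : 'rV[R]_n => C * riesz m x) ->
  - (2 * m%:R / n%:R) < a ->
  1 <= p -> p < (n%:R + 2 * m%:R + 2 * a) / (n%:R - 2 * m%:R) ->
  {within closure (@halfspace R n), continuous u} ->
  (forall x, closure (@halfspace R n) x -> 0 <= u x) ->
  (forall x, @halfspace R n x ->
     ((u x)%:E = \int[lebesgue_measure_rV n]_(y in @halfspace R n)
       (green_halfspace C m x y * last_coord y `^ a * u y `^ p)%:E)%E) ->
  forall x, closure (@halfspace R n) x -> u x = 0.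
Proof.
case: n u => [|n'] // {}u m1 mn C0 _ ha p1 hp cu u0 equ.
pose g := (n'.+1 - 2 * m)%N.
have dim : n'.+1 = (g + 2 * m)%N by rewrite subnK // ltnW.
have g0 : (0 < g)%N by rewrite subn_gt0.
have dimR : n'.+1%:R = g%:R + 2 * m%:R :> R by rewrite {1}dim natrD natrM.
have N0 : 0 < n'.+1%:R :> R by rewrite ltr0n.
have ag : g%:R / n'.+1%:R + Num.max 0 (- a) < 1.
  have gE : g%:R / n'.+1%:R = 1 - 2 * m%:R / n'.+1%:R :> R.
    have -> : g%:R = n'.+1%:R - 2 * m%:R :> R by rewrite dimR addrK.
    by rewrite mulrBl divff // gt_eqF.
  have M0 : 0 < 2 * m%:R / n'.+1%:R :> R by rewrite divr_gt0 // mulr_gt0 // ltr0n.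
  have : Num.max 0 (- a) < 2 * m%:R / n'.+1%:R by rewrite gt_max M0 ltrNl.
  by rewrite gE addrAC ltrBlDr ltrD2l.
have tau0 : 0 < n'.+1%:R + 2 * m%:R + 2 * a - p * g%:R.
  have gR0 : 0 < g%:R :> R by rewrite ltr0n.
  by move: hp; rewrite {2}dimR addrK ltr_pdivlMr // subr_gt0.
(* Nothing is known about [u] off the closed half-space. Extended by zero it becomes measurable and
   nonnegative everywhere, and the integral equation on the half-space is unchanged. *)
pose H := @halfspace R n'.+1; pose U x := if `[< H x >] then u x else 0.
have UH x : H x -> U x = u x by move=> Hx; rewrite /U asboolT.
have UN x : ~ H x -> U x = 0 by move=> Hx; rewrite /U asboolF.
have oH : open H := @open_halfspace R n'.
have Hcl x : H x -> closure H x by exact: subset_closure.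
have cuH x : H x -> {for x, continuous u}.
  have := continuous_subspaceW Hcl cu.
  rewrite continuous_open_subspace // => h Hx; apply: h; exact/mem_set.
have U0 x : 0 <= U x.
  by rewrite /U; case: asboolP => // Hx; exact/u0/Hcl.
have mU : measurable_fun setT U by exact: measurable_fun_continuous_in.
have cU x : H x -> {for x, continuous U}.
  move=> Hx; have c : u y @[y --> x] --> U x by rewrite UH //; exact: cuH.
  have HH : nbhs x H by exact: open_nbhs_nbhs.
  by move=> A /c; apply: filterS2 HH => y Hy; rewrite /= UH.
(* Continuity up to the boundary matters here: it bounds [u] on bounded parts of the closed
   half-space, which are compact. *)
have bU L : exists2 M, 0 <= M & forall x, enorm x < L -> U x <= M.
  pose K := closure H `&` [set x | enorm x <= L].
  have cK : compact K.
    apply: (@closed_coord_bounded_compact _ _ _ L).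
      apply: closedI; first exact: closed_closure.
      exact: (closed_comp (f := @enorm R n'.+1)
        (fun x _ => @enorm_continuous R n'.+1 x) (@closed_le _ L)).
    by move=> y i [_ yL]; exact: (le_trans (coord_le_enorm _ _)).
  have cuK : {within K, continuous u} by apply: continuous_subspaceW cu => x [].
  have /compact_bounded [M [Mr hM]] := continuous_compact cuK cK.
  exists (`|M| + 1); first by rewrite addr_ge0.
  move=> x xL; rewrite /U; case: asboolP => Hx; last by rewrite addr_ge0.
  apply: (le_trans (ler_norm _)); apply: (hM (`|M| + 1)).
    by rewrite (le_lt_trans (ler_norm M)) // ltrDl.
  by exists x => //; split; [exact: Hcl|exact: ltW].
have eqU x : H x -> (U x)%:E = (\int[lebesgue_measure_rV n'.+1]_(y in H)
    (C * gkernel g x y * last_coord y `^ a * U y `^ p)%:E)%E.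
  move=> Hx; rewrite UH // equ //; apply: eq_integral => y; rewrite inE => Hy.
  by rewrite UH.
have u_eq0 x : H x -> u x = 0.
  move=> Hx; rewrite -UH //.
  exact: (u_eq0_halfspace dim g0 C0 p1 ag tau0 mU U0 UN cU bU eqU).
(* A nonzero value at a boundary point would persist, by continuity within the closure, at nearby
   points of the half-space. *)
move=> x clx; apply/eqP/negPn/negP => ux.
have /subspace_continuousP/(_ x clx) cux := cu.
have /cux : nbhs (u x) [set t | t != 0].
  by apply: open_nbhs_nbhs; split => //; exact: open_neq.
rewrite /within /= => near_ux.
have [y [Hy hy]] := clx _ near_ux.
have : u y != 0 by exact: (hy (Hcl y Hy)).
by rewrite u_eq0 // eqxx.
Qed.
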